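(* Suppose that $\{\mathbf X(t):t\ge0\}$ is a 2-type Markov branching process with $\mathbf X(0)=\mathbf e_k$ ($k=1$ or $2$), with birth-counting processes $\mathbf Y(t)=(Y_{\mathbf m}(t):\mathbf m\in R_1)$ and $\mathbf Z(t)=(Z_{\mathbf m}(t):\mathbf m\in R_2)$. Let $\mathbf G(t,\mathbf x,\mathbf y,\mathbf z)=(g_1(t,\mathbf x,\mathbf y,\mathbf z),g_2(t,\mathbf x,\mathbf y,\mathbf z))$ be the unique solution $\mathbf u(t)=(u_1(t),u_2(t))$ of $$\frac{\partial u_1}{\partial t}=B_1(\mathbf u,\mathbf y)+\bar B_1(\mathbf u),\qquad \frac{\partial u_2}{\partial t}=B_2(\mathbf u,\mathbf z)+\bar B_2(\mathbf u),\qquad \mathbf u(0)=\mathbf x.$$ Then the joint probability generating function of $(\mathbf Y(t),\mathbf Z(t))$ is given by $$E[\mathbf y^{\mathbf Y(t)}\mathbf z^{\mathbf Z(t)}\mid\mathbf X(0)=\mathbf e_k]=g_k(t,\mathbf 1,\mathbf y,\mathbf z),\qquad(\mathbf y,\mathbf z)\in[0,1)^{r_1+r_2},\ k=1,2.$$ In particular, the probability generating functions of $\mathbf Y(t)$ and of $\mathbf Z(t)$ are given by $$E[\mathbf y^{\mathbf Y(t)}\mid\mathbf X(0)=\mathbf e_k]=g_k(t,\mathbf 1,\mathbf y,\mathbf 1),\qquad\mathbf y\in[0,1)^{r_1},\ k=1,2,$$ and $$E[\mathbf z^{\mathbf Z(t)}\mid\mathbf X(0)=\mathbf e_k]=g_k(t,\mathbf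 1,\mathbf 1,\mathbf z),\qquad\mathbf z\in[0,1)^{r_2},\ k=1,2,$$ respectively.
   Context: Notation: $\mathbf Z_+$ is the set of nonnegative integers; $\mathbf e_1=(1,0)$, $\mathbf e_2=(0,1)$; $\mathbf 0$ and $\mathbf 1$ are vectors of zeros and ones. For $\mathbf x=(x_1,x_2)$ and $\mathbf j=(j_1,j_2)\in\mathbf Z_+^2$, $\mathbf x^{\mathbf j}=x_1^{j_1}x_2^{j_2}$ (with $0^0=1$). Data: for $k=1,2$, $(b^{(k)}_{\mathbf j})_{\mathbf j\in\mathbf Z_+^2}$ are real numbers with $b^{(k)}_{\mathbf j}\ge0$ for $\mathbf j\ne\mathbf e_k$ and $b^{(k)}_{\mathbf e_k}=-\sum_{\mathbf j\neq\mathbf e_k}b^{(k)}_{\mathbf j}$ (finite); $b^{(k)}_{\mathbf j}=0$ for $\mathbf j\notin\mathbf Z_+^2$. Put $B_k(\mathbf x)=\sum_{\mathbf j\in\mathbf Z_+^2}b^{(k)}_{\mathbf j}\mathbf x^{\mathbf j}$ for $\mathbf x\in[0,1]^2$ and $B_{ij}(\mathbf x)=\partial B_i(\mathbf x)/\partial x_j$. Standing assumptions: (A-1) there is no $2\times2$ matrix $M$ with $(B_1(\mathbf x),B_2(\mathbf x))=\mathbf xM$; (A-2) $B_{ij}(1,1)<\infty$ for $i,j=1,2$; (A-3) there is an integer $m$ such that all entries of $(B_{ij}(1,1):i,j=1,2)^m$ are positive. $R_1,R_2\subset\mathbf Z_+^2$ are finite nonempty sets with $b^{(k)}_{\mathbf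 j}>0$ for all $\mathbf j\in R_k$; $r_k$ is the number of elements of $R_k$; $R_k^c=\mathbf Z_+^2\setminus R_k$. Vectors $\mathbf y=(y_{\mathbf j}:\mathbf j\in R_1)$ and $\mathbf z=(z_{\mathbf j}:\mathbf j\in R_2)$ are indexed by $R_1,R_2$; $\mathbf y^{\mathbf l}=\prod_{\mathbf m\in R_1}y_{\mathbf m}^{l_{\mathbf m}}$ and $\mathbf z^{\tilde{\mathbf l}}=\prod_{\mathbf m\in R_2}z_{\mathbf m}^{\tilde l_{\mathbf m}}$. Define $$B_1(\mathbf x,\mathbf y)=\sum_{\mathbf j\in R_1}b^{(1)}_{\mathbf j}\mathbf x^{\mathbf j}y_{\mathbf j},\quad \bar B_1(\mathbf x)=\sum_{\mathbf j\in R_1^c}b^{(1)}_{\mathbf j}\mathbf x^{\mathbf j},\quad B_2(\mathbf x,\mathbf z)=\sum_{\mathbf j\in R_2}b^{(2)}_{\mathbf j}\mathbf x^{\mathbf j}z_{\mathbf j},\quad \bar B_2(\mathbf x)=\sum_{\mathbf j\in R_2^c}b^{(2)}_{\mathbf j}\mathbf x^{\mathbf j}.$$ The differential equation is considered for $t\ge0$ and all parameters $(\mathbf x,\mathbf y,\mathbf z)\in[0,1]^{2+r_1+r_2}$, with solutions valued in $[0,1]^2$. Process: $(\mathbf X(t),\mathbf Y(t),\mathbf Z(t))$ is the continuous-time Markov chain on $\mathbf Z_+^{2}\times\mathbf Z_+^{r_1}\times\mathbf Z_+^{r_2}$ with $Q$-matrix $\tilde Q$ given by $$\tilde q_{(\mathbf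 i,\mathbf k,\tilde{\mathbf k}),(\mathbf j,\mathbf l,\tilde{\mathbf l})}=i_1b^{(1)}_{\mathbf j-\mathbf i+\mathbf e_1}\,\mathbb 1\{\mathbf l=\mathbf k+I_{R_1}(\mathbf j-\mathbf i+\mathbf e_1)\varepsilon_{\mathbf j-\mathbf i+\mathbf e_1},\ \tilde{\mathbf l}=\tilde{\mathbf k}\}+i_2b^{(2)}_{\mathbf j-\mathbf i+\mathbf e_2}\,\mathbb 1\{\mathbf l=\mathbf k,\ \tilde{\mathbf l}=\tilde{\mathbf k}+I_{R_2}(\mathbf j-\mathbf i+\mathbf e_2)\tilde\varepsilon_{\mathbf j-\mathbf i+\mathbf e_2}\},$$ where $I_{R_k}$ is the indicator of $R_k$ and $\varepsilon_{\mathbf m}\in\mathbf Z_+^{r_1}$ ($\mathbf m\in R_1$), $\tilde\varepsilon_{\mathbf m}\in\mathbf Z_+^{r_2}$ ($\mathbf m\in R_2$) are the unit vectors with $1$ at coordinate $\mathbf m$; initially $\mathbf Y(0)=\mathbf 0$ and $\mathbf Z(0)=\mathbf 0$. Thus $\mathbf X(t)$ is the 2-type Markov branching process in which a type-$a$ individual is replaced by $j_1$ type-1 and $j_2$ type-2 individuals at rate $b^{(a)}_{\mathbf j}$ ($\mathbf j\neq\mathbf e_a$), and, for $\mathbf m\in R_1$ (resp. $R_2$), $Y_{\mathbf m}(t)$ (resp. $Z_{\mathbf m}(t)$) counts the type-1 (resp. type-2) individuals that have split into offspring vector $\mathbf m$ up to time $t$. Under the standing assumptions the chain is regular (non-explosive).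 *)

(* Defs.v *)
From mathcomp Require Import all_boot all_order all_algebra finmap.
From mathcomp Require Import all_classical all_reals all_analysis.

Set Implicit Arguments.
Unset Strict Implicit.
Unset Printing Implicit Defensive.

Import Order.TTheory GRing.Theory Num.Theory.
Import numFieldNormedType.Exports.

Local Open Scope classical_set_scope.
Local Open Scope ring_scope.

(* Types 1 and 2 are the elements 0 and 1 of 'I_2. *)
Notation vec := {ffun 'I_2 -> nat}.

Definition unitv (k : 'I_2) : vec := [ffun a => (a == k) : nat].

(* Differences of elements of vec are formed in Z^2. *)
Definition zvec (j : vec) : {ffun 'I_2 -> int} := [ffun a => (j a)%:Z].

(* Sum of a family of reals; meaningful for absolutely summable families. *)
Definition csum (R : realType) (T : choiceType) (A : set T) (f : T -> R) : R :=
  fine (esum A (EFin \o f)^\+%E) - fine (esum A (EFin \o f)^\-%E).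

Definition in_cube (R : realType) (I : finType) (x : I -> R) : Prop :=
  forall a, 0 <= x a <= 1.

Definition in_halfopen_cube (R : realType) (I : finType) (x : I -> R) : Prop :=
  forall a, 0 <= x a < 1.

(* x^j, with 0^0 = 1 *)
Definition monom (R : realType) (I : finType) (x : I -> R) (j : I -> nat) : R :=
  \prod_(a : I) x a ^+ j a.

Record offspring_rates (R : realType) (b : 'I_2 -> vec -> R) : Prop := {
  rate_ge0 : forall k j, j != unitv k -> 0 <= b k j;
  rate_diag : forall k,
    (\esum_(j in [set j | j != unitv k]) (b k j)%:E = (- b k (unitv k))%:E)%E
}.

Definition genB (R : realType) (b : 'I_2 -> vec -> R) (k : 'I_2)
    (x : 'rV[R]_2) : R :=
  csum setT (fun j : vec => b k j * monom (x 0) j).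

(* Partial derivative relative to [0,1]^2 (hence one-sided on the boundary),
   with values in the extended reals. *)
Definition partialB (R : realType) (b : 'I_2 -> vec -> R) (i j : 'I_2)
    (x : 'rV[R]_2) : \bar R :=
  lim (((genB b i (x + h *: delta_mx 0 j) - genB b i x) / h)%:E
    @[h --> within [set h : R | in_cube ((x + h *: delta_mx 0 j) 0)] 0^']).

Definition meanB (R : realType) (b : 'I_2 -> vec -> R) : 'M[R]_2 :=
  \matrix_(i, j) fine (partialB b i j (const_mx 1)).

Definition assumption_A1 (R : realType) (b : 'I_2 -> vec -> R) : Prop :=
  ~ exists M : 'M[R]_2, forall x : 'rV[R]_2, in_cube (x 0) ->
      \row_k genB b k x = x *m M.

Definition assumption_A2 (R : realType) (b : 'I_2 -> vec -> R) : Prop :=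
  forall i j : 'I_2, (partialB b i j (const_mx 1%R) < +oo)%E.

Definition assumption_A3 (R : realType) (b : 'I_2 -> vec -> R) : Prop :=
  exists m : nat, forall i j : 'I_2, 0 < (meanB b ^+ m) i j.

(* B_k(x, v), where v is indexed by the finite set A *)
Definition markedB (R : realType) (b : 'I_2 -> vec -> R) (k : 'I_2)
    (A : {fset vec}) (x : 'rV[R]_2) (v : {ffun A -> R}) : R :=
  \sum_(m : A) b k (val m) * monom (x 0) (val m) * v m.

Definition unmarkedB (R : realType) (b : 'I_2 -> vec -> R) (k : 'I_2)
    (A : {fset vec}) (x : 'rV[R]_2) : R :=
  csum [set j : vec | j \notin A] (fun j => b k j * monom (x 0) j).

Definition has_derivative_within (R : realType) (D : set R) (f : R -> R)
    (t l : R) : Prop :=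
  (f (t + h) - f t) / h @[h --> within [set h | D (t + h)] 0^'] --> l.

(* Solutions on [0, +oo[ with values in [0,1]^2; the values of u at negative
   times are irrelevant. *)
Record ode_solution (R : realType) (b : 'I_2 -> vec -> R) (R1 R2 : {fset vec})
    (x : 'rV[R]_2) (y : {ffun R1 -> R}) (z : {ffun R2 -> R})
    (u : R -> 'rV[R]_2) : Prop := {
  ode_range : forall t, 0 <= t -> in_cube (u t 0);
  ode_init : u 0 = x;
  ode_eq1 : forall t, 0 <= t ->
    has_derivative_within [set s | 0 <= s] (fun s => u s 0 0) t
      (markedB b 0 (u t) y + unmarkedB b 0 R1 (u t));
  ode_eq2 : forall t, 0 <= t ->
    has_derivative_within [set s | 0 <= s] (fun s => u s 0 1) t
      (markedB b 1 (u t) z + unmarkedB b 1 R2 (u t))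
}.

Definition unique_ode_solution (R : realType) (b : 'I_2 -> vec -> R)
    (R1 R2 : {fset vec}) (x : 'rV[R]_2) (y : {ffun R1 -> R})
    (z : {ffun R2 -> R}) (u : R -> 'rV[R]_2) : Prop :=
  ode_solution b x y z u /\
  forall v, ode_solution b x y z v -> forall t, 0 <= t -> v t = u t.

(* Transition functions may a priori be substochastic. *)
Record transition_function (R : realType) (S : countType)
    (p : R -> S -> S -> R) : Prop := {
  trans_ge0 : forall t i j, 0 <= t -> 0 <= p t i j;
  trans_le1 : forall t i, 0 <= t -> (\esum_(j in setT) (p t i j)%:E <= 1)%E;
  trans_0 : forall i j, p 0 i j = (i == j)%:R;
  trans_CK : forall s t i j, 0 <= s -> 0 <= t ->
    (\esum_(k in setT) (p s i k * p t k j)%:E = (p (s + t) i j)%:E)%E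
}.

Definition has_Qmatrix (R : realType) (S : countType) (p : R -> S -> S -> R)
    (q : S -> S -> R) : Prop :=
  forall i j, (p h i j - (i == j)%:R) / h @[h --> 0^'+] --> q i j.

(* Continuous-time Markov chain on the countable state space S, observed at
   nonnegative times. *)
Record markov_chain (R : realType) (S : countType) (q : S -> S -> R)
    (d : measure_display) (Omega : measurableType d) (P : probability Omega R)
    (W : R -> Omega -> S) : Prop := {
  chain_measurable : forall t s, 0 <= t -> measurable [set w | W t w = s];
  chain_markov : exists p : R -> S -> S -> R,
    [/\ transition_function p, has_Qmatrix p q &
     forall (n : nat) (tau : 'I_n -> R) (sigma : 'I_n -> S) (s t : R) (i j : S),
       (forall m, 0 <= tau m <= s) -> 0 <= s -> 0 <= t ->
       P [set w | [/\ forall m, W (tau m) w = sigma m,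
                      W s w = i & W (s + t) w = j]] =
       (P [set w | (forall m, W (tau m) w = sigma m) /\ W s w = i]
         * (p t i j)%:E)%E]
}.

Notation bstate R1 R2 := (vec * {ffun R1 -> nat} * {ffun R2 -> nat})%type.

(* Extension by zero of b^(k) from Z_+^2 to Z^2 *)
Definition zrate (R : realType) (b : 'I_2 -> vec -> R) (k : 'I_2)
    (m : {ffun 'I_2 -> int}) : R :=
  if [forall a, 0 <= m a] then b k [ffun a => `|m a|%N] else 0.

(* I_A(m) times the unit vector at coordinate m *)
Definition mark (A : {fset vec}) (m : {ffun 'I_2 -> int}) : {ffun A -> nat} :=
  [ffun a => (zvec (val a) == m) : nat].

Definition addc (A : finType) (k l : {ffun A -> nat}) : {ffun A -> nat} :=
  [ffun a => (k a + l a)%N].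

Definition birth_Q (R : realType) (b : 'I_2 -> vec -> R) (R1 R2 : {fset vec})
    (s s' : bstate R1 R2) : R :=
  let: (i, k, k') := s in
  let: (j, l, l') := s' in
  let m1 := zvec j - zvec i + zvec (unitv 0) in
  let m2 := zvec j - zvec i + zvec (unitv 1) in
  (i 0)%:R * zrate b 0 m1 * ((l == addc k (mark R1 m1)) && (l' == k'))%:R
  + (i 1)%:R * zrate b 1 m2 * ((l == k) && (l' == addc k' (mark R2 m2)))%:R.

(* A 2-type Markov branching process X together with its birth counts Y and Z,
   started from one individual of type k *)
Record branching_with_counts (R : realType) (b : 'I_2 -> vec -> R)
    (R1 R2 : {fset vec}) (k : 'I_2) (d : measure_display)
    (Omega : measurableType d) (P : probability Omega R)
    (X : R -> Omega -> vec) (Y : R -> Omega -> {ffun R1 -> nat})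
    (Z : R -> Omega -> {ffun R2 -> nat}) : Prop := {
  branching_chain : markov_chain (@birth_Q R b R1 R2) P
    (fun t w => (X t w, Y t w, Z t w) : bstate R1 R2);
  branching_init :
    P [set w | [/\ X 0 w = unitv k, Y 0 w = [ffun=> 0%N]
                 & Z 0 w = [ffun=> 0%N]]] = 1%E
}.

(* Main.v *)
Require Import Defs.
From HB Require Import structures.
From mathcomp Require Import all_boot all_order all_algebra finmap.
From mathcomp Require Import all_classical all_reals all_analysis.
From mathcomp Require Import ring lra zify.

Set Implicit Arguments.
Unset Strict Implicit.
Unset Printing Implicit Defensive.

Import Order.TTheory GRing.Theory Num.Theory.
Import numFieldNormedType.Exports.

Local Open Scope classical_set_scope.
Local Open Scope ring_scope.

(** Write q for the generator of the chain (X, Y, Z), s = (i, l, l') for a state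
and W_t(s) for the expectation of y^Y(t) z^Z(t) for the chain started at s.
Two functions of (t, s) are compared:

- the expectation W_t(s) = sum_s' p_t(s, s') y^(l of s') z^(l' of s'), built from
  the transition function p of the chain;
- the product U_t(s) = y^l z^l' u_1(t)^i_1 u_2(t)^i_2, where u solves the
  differential equation with u(0) = (1, 1).

Individuals reproduce independently, so W should have the product form of U.
The proof of this is that both are bounded, agree at t = 0, and solve the
Kolmogorov backward equation dW/dt = qW.  For W this is a general fact about
transition functions with a conservative Q-matrix ([transition_backward]): by
Fatou's lemma, applied to F and to 1 - F, the quotient (p_h F - F)/h tends to qF
at each state, uniformly over functions F with values in [0, 1].  For U it is
the chain rule: a split of a type-a individual into j replaces one factor u_a of
the product by u^j times the mark of j, which is exactly a term of the
right-hand side of the differential equation ([generator_state_pgf],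
[ode_backward]).  Evaluated at a single individual of type k, U is u_k.

Bounded solutions of the backward equation are unique because the chain does not
explode.  Non-explosion enters through the Lyapunov function V = 1 + i_1 + i_2:
the finite derivatives B_ij(1,1) are the first moments of the offspring laws
([moment_summable]), so that qV <= cV ([population_lyapunov]).  If the difference
of two solutions is at most K V e^((c+1)t), a comparison argument improves K to
theta K on the states with V <= N, with theta < 1 depending on N, whereas on the
states with V > N the bound 1 on the difference already gives the constant 1/N.
Iterating and then letting N tend to infinity makes the difference vanish
([backward_unique]).

The same uniqueness theorem gives uniqueness for the differential equation,
since a solution u is recovered from its U.  Existence comes from the Euler
scheme: with finite first moments the right-hand side is Lipschitz on the unit
square, and Euler steps of small size stay in the square ([ode_exists]). *)

(** * Sums of nonnegative reals *)

(** Meaningful when [f] is nonnegative on [A] and [rsummable A f] holds; keeping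
the sum in the field leaves the estimates below to linear arithmetic. *)
Definition rsum (R : realType) (T : choiceType) (A : set T) (f : T -> R) : R :=
  fine (\esum_(i in A) (f i)%:E)%E.

Definition rsummable (R : realType) (T : choiceType) (A : set T) (f : T -> R) : Prop :=
  (\esum_(i in A) (f i)%:E < +oo)%E.

Section RealSums.
Variables (R : realType) (T : choiceType).
Implicit Types (A : set T) (f g : T -> R).

Lemma esum_rsum A f : (forall i, A i -> 0 <= f i) -> rsummable A f ->
  (\esum_(i in A) (f i)%:E = (rsum A f)%:E)%E.
Proof.
move=> f0 sf; rewrite /rsum fineK// ge0_fin_numE//.
by apply: esum_ge0 => i Ai; rewrite lee_fin f0.
Qed.

Lemma rsummableP A f s : (\esum_(i in A) (f i)%:E = s%:E)%E ->
  rsummable A f /\ rsum A f = s.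
Proof. by move=> e; rewrite /rsummable /rsum e; split=> //; exact: ltry. Qed.

Lemma rsum_ge0 A f : (forall i, A i -> 0 <= f i) -> 0 <= rsum A f.
Proof. by move=> f0; rewrite fine_ge0// esum_ge0// => i Ai; rewrite lee_fin f0. Qed.

Lemma eq_rsum A f g : (forall i, A i -> f i = g i) -> rsum A f = rsum A g.
Proof. by move=> e; congr fine; apply: eq_esum => i /e ->. Qed.

Lemma eq_rsummable A f g : (forall i, A i -> f i = g i) -> rsummable A f -> rsummable A g.
Proof. by move=> e; rewrite /rsummable; under eq_esum do rewrite e//. Qed.

Lemma rsummable_le A f g : (forall i, A i -> f i <= g i) ->
  rsummable A g -> rsummable A f.
Proof.
by move=> fg; apply: le_lt_trans; apply: le_esum => i /fg; rewrite lee_fin.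
Qed.

Lemma rsum_le A f g : (forall i, A i -> 0 <= f i <= g i) -> rsummable A g ->
  rsum A f <= rsum A g.
Proof.
move=> fg sg.
have f0 i : A i -> 0 <= f i by move=> /fg /andP[].
have g0 i : A i -> 0 <= g i by move=> /fg /andP[]; exact: le_trans.
have le i : A i -> f i <= g i by move=> /fg /andP[].
rewrite -lee_fin -!esum_rsum//; last exact: rsummable_le sg.
by apply: le_esum => i /le; rewrite lee_fin.
Qed.

Lemma esumD_EFin A f g : (forall i, A i -> 0 <= f i) -> (forall i, A i -> 0 <= g i) ->
  (\esum_(i in A) (f i + g i)%:E =
   \esum_(i in A) (f i)%:E + \esum_(i in A) (g i)%:E)%E.
Proof.
by move=> f0 g0; rewrite -esumD// => i Ai; rewrite lee_fin ?f0 ?g0.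
Qed.

Lemma rsummableD A f g : (forall i, A i -> 0 <= f i) -> (forall i, A i -> 0 <= g i) ->
  rsummable A f -> rsummable A g -> rsummable A (fun i => f i + g i).
Proof. by move=> f0 g0 sf sg; rewrite /rsummable esumD_EFin// lte_add_pinfty. Qed.

Lemma rsumD A f g : (forall i, A i -> 0 <= f i) -> (forall i, A i -> 0 <= g i) ->
  rsummable A f -> rsummable A g ->
  rsum A (fun i => f i + g i) = rsum A f + rsum A g.
Proof.
move=> f0 g0 sf sg; apply: EFin_inj.
rewrite EFinD -!esum_rsum ?esumD_EFin//; first by move=> i Ai; rewrite addr_ge0 ?f0 ?g0.
exact: rsummableD.
Qed.

Lemma esum_ge_fset A f (X : {fset T}) : [set` X] `<=` A ->
  ((\sum_(i <- X) f i)%:E <= \esum_(i in A) (f i)%:E)%E.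
Proof.
move=> XA; apply: ereal_sup_ubound; exists [set` X]; first by split.
by rewrite fsbig_finite// set_fsetK sumEFin.
Qed.

Lemma esum_le_ub A f (c : \bar R) :
  (forall X : {fset T}, [set` X] `<=` A -> ((\sum_(i <- X) f i)%:E <= c)%E) ->
  (\esum_(i in A) (f i)%:E <= c)%E.
Proof.
move=> H; apply: ge_ereal_sup => _ [X [finX XA] <-].
rewrite fsbig_finite// sumEFin; apply: H.
by move=> i /=; rewrite in_fset_set// inE => /XA.
Qed.

Lemma rsummable_sub A B f : A `<=` B -> rsummable B f -> rsummable A f.
Proof.
move=> AB; apply: le_lt_trans; apply: esum_le_ub => X XA.
by apply: esum_ge_fset; exact: subset_trans AB.
Qed.

Lemma esum_scale (c : R) A f : 0 <= c -> (forall i, A i -> 0 <= f i) ->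
  (\esum_(i in A) (c * f i)%:E = c%:E * \esum_(i in A) (f i)%:E)%E.
Proof.
have le (d : R) (h : T -> R) : 0 <= d ->
    (\esum_(i in A) (d * h i)%:E <= d%:E * \esum_(i in A) (h i)%:E)%E.
  move=> d0; apply: esum_le_ub => X XA.
  by rewrite -mulr_sumr EFinM lee_wpmul2l ?lee_fin// esum_ge_fset.
move=> c0 f0; have [->|cn0] := eqVneq c 0.
  by rewrite mul0e esum1// => i _; rewrite mul0r.
have cp : 0 < c by rewrite lt_neqAle eq_sym cn0.
apply/eqP; rewrite eq_le le//= -lee_pdivlMl//.
rewrite (le_trans _ (le c^-1 (fun i => c * f i) _)) ?invr_ge0//.
by apply: le_esum => i Ai; rewrite mulKf.
Qed.

Lemma rsummableZ (c : R) A f : 0 <= c -> (forall i, A i -> 0 <= f i) ->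
  rsummable A f -> rsummable A (fun i => c * f i).
Proof.
by move=> c0 f0 sf; rewrite /rsummable esum_scale// esum_rsum// -EFinM ltry.
Qed.

Lemma rsumZ (c : R) A f : 0 <= c -> (forall i, A i -> 0 <= f i) ->
  rsummable A f -> rsum A (fun i => c * f i) = c * rsum A f.
Proof. by move=> c0 f0 sf; rewrite {1}/rsum esum_scale// esum_rsum. Qed.

Lemma rsum_ge_fset A f (X : {fset T}) : (forall i, A i -> 0 <= f i) ->
  rsummable A f -> [set` X] `<=` A -> \sum_(i <- X) f i <= rsum A f.
Proof.
by move=> f0 sf XA; rewrite -lee_fin -esum_rsum//; exact: esum_ge_fset.
Qed.

(** The only form in which convergence of a sum is used: up to [e], the sum is a
finite one. *)
Lemma rsum_approx A f e : (forall i, A i -> 0 <= f i) -> rsummable A f ->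
  0 < e -> exists X : {fset T}, [set` X] `<=` A /\
                                rsum A f <= \sum_(i <- X) f i + e.
Proof.
move=> f0 sf e0.
have : ((rsum A f - e)%:E < \esum_(i in A) (f i)%:E)%E.
  by rewrite esum_rsum// lte_fin ltrBlDr ltrDl.
move=> /ereal_sup_gt[_ [X [finX XA] <-]].
rewrite fsbig_finite// sumEFin lte_fin => /ltW H.
exists (fset_set X); split; last by rewrite -lerBlDr.
by move=> i /=; rewrite in_fset_set// inE => /XA.
Qed.

End RealSums.

(** * Small-time behaviour of a transition function *)

Record conservative (R : realType) (S : countType) (q : S -> S -> R) : Prop := {
  conservative_ge0 : forall i k, k != i -> 0 <= q i k;
  conservative_row : forall i,
    (\esum_(k in [set k | k != i]) (q i k)%:E = (- q i i)%:E)%E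
}.

(** The off-diagonal part of the generator.  It is kept apart because it is
monotone in [F], while the diagonal term carries a negative coefficient. *)
Definition jump (R : realType) (S : countType) (q : S -> S -> R) (F : S -> R)
    (i : S) : R := rsum [set k | k != i] (fun k => q i k * F k).

Definition generator (R : realType) (S : countType) (q : S -> S -> R)
    (F : S -> R) (i : S) : R := jump q F i + q i i * F i.

Definition average (R : realType) (S : countType) (p : R -> S -> S -> R)
    (F : S -> R) (t : R) (i : S) : R := rsum setT (fun j => p t i j * F j).

Section Jump.
Variables (R : realType) (S : countType) (q : S -> S -> R).
Hypothesis hq : conservative q.

Lemma rate_summable i : rsummable [set k | k != i] (q i).
Proof. by have [] := rsummableP (conservative_row hq i). Qed.

Lemma jump_summable i (F : S -> R) M : (forall k, F k <= M) ->
  rsummable [set k | k != i] (fun k => q i k * F k).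
Proof.
move=> FM.
apply: (@rsummable_le _ _ _ _ (fun k => `|M| * q i k)).
  move=> k ki; rewrite mulrC ler_wpM2r ?(conservative_ge0 hq)//.
  by rewrite (le_trans (FM k))// ler_norm.
apply: rsummableZ => // [k ki|]; first exact: conservative_ge0.
exact: rate_summable.
Qed.

Lemma jump_ge0 i F : (forall k, 0 <= F k) -> 0 <= jump q F i.
Proof. by move=> F0; apply: rsum_ge0 => k ki; rewrite mulr_ge0// (conservative_ge0 hq). Qed.

(** Conservativity gives the symmetry between [F] and [1 - F] that turns every
lower bound on the generator into an upper bound. *)
Lemma jump_compl i F : (forall k, 0 <= F k <= 1) ->
  jump q (fun k => 1 - F k) i = - q i i - jump q F i.
Proof.
move=> F01.
have F0 k : 0 <= F k by case/andP: (F01 k).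
have F1 k : F k <= 1 by case/andP: (F01 k).
apply/eqP; rewrite -subr_eq opprK; apply/eqP.
rewrite /jump -rsumD; first last.
- exact: jump_summable F1.
- by apply: (@jump_summable _ _ 1) => k; rewrite gerBl.
- by move=> k ki; rewrite mulr_ge0// (conservative_ge0 hq).
- by move=> k ki; rewrite mulr_ge0 ?subr_ge0// (conservative_ge0 hq).
rewrite (eq_rsum (g := q i)); last by move=> k _; ring.
by have [] := rsummableP (conservative_row hq i).
Qed.

(** One finite set serves all [F]: it is chosen to catch the total jump rate up
to [e], and the part of [jump q F i] outside it is at most the rate left over. *)
Lemma jump_approx i e : 0 < e -> exists X : {fset S}, i \notin X /\
  forall F, (forall k, 0 <= F k <= 1) ->
    jump q F i <= \sum_(k <- X) q i k * F k + e.
Proof.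
move=> e0.
have [X [Xi HX]] := rsum_approx (fun k ki => conservative_ge0 hq ki) (rate_summable i) e0.
exists X; split; first by apply/negP => /Xi /=; rewrite eqxx.
move=> F F01.
have F1 k : 1 - F k <= 1 by case/andP: (F01 k) => ? ?; lra.
(* The finite sum of q i k (1 - F k) is at most the whole one; complement
   both with respect to the sums of q i k. *)
have Hfs := @rsum_ge_fset R S [set k | k != i] (fun k => q i k * (1 - F k)) X.
have q0 k : k != i -> 0 <= q i k * (1 - F k).
  by move=> ki; rewrite mulr_ge0 ?(conservative_ge0 hq)//; case/andP: (F01 k) => ? ?; lra.
move: Hfs => /(_ q0 (jump_summable i F1) Xi).
rewrite -/(jump q (fun k => 1 - F k) i) jump_compl//.
have [_ <-] := rsummableP (conservative_row hq i).
under eq_bigr do rewrite mulrBr mulr1.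
rewrite sumrB => H1.
lra.
Qed.

End Jump.

Section SmallTime.
Variables (R : realType) (S : countType) (q : S -> S -> R) (p : R -> S -> S -> R).
Hypotheses (hq : conservative q) (hp : transition_function p) (hpq : has_Qmatrix p q).
Implicit Types (F : S -> R).

Lemma trans_summable t i : 0 <= t -> rsummable setT (p t i).
Proof. by move=> t0; apply: (le_lt_trans (trans_le1 hp i t0)); rewrite ltry. Qed.

Lemma trans_sum_le1 t i : 0 <= t -> rsum setT (p t i) <= 1.
Proof.
move=> t0; rewrite -lee_fin -esum_rsum ?(trans_le1 hp)//; last exact: trans_summable.
by move=> j _; exact: trans_ge0.
Qed.

Lemma average_summable t i F : 0 <= t -> (forall k, 0 <= F k <= 1) ->
  rsummable setT (fun j => p t i j * F j).
Proof.
move=> t0 F01; apply: rsummable_le (trans_summable i t0) => j _.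
by case/andP: (F01 j) => ? ?; rewrite ler_piMr// (trans_ge0 hp).
Qed.

Lemma average_compl t i F : 0 <= t -> (forall k, 0 <= F k <= 1) ->
  average p F t i <= 1 - average p (fun k => 1 - F k) t i.
Proof.
move=> t0 F01; rewrite lerBrDr /average -rsumD; first last.
- by apply: average_summable => // k; case/andP: (F01 k) => ? ?; apply/andP; split; lra.
- exact: average_summable.
- by move=> k _; rewrite mulr_ge0 ?(trans_ge0 hp)//; case/andP: (F01 k) => ? ?; lra.
- by move=> k _; rewrite mulr_ge0 ?(trans_ge0 hp)//; case/andP: (F01 k) => ? ?; lra.
rewrite (eq_rsum (g := p t i)) ?trans_sum_le1//.
by move=> j _; ring.
Qed.

Lemma trans_small_time i e (s : seq S) : 0 < e -> exists2 d, 0 < d &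
  forall h, 0 < h < d -> forall k, k \in s ->
    `|p h i k - (i == k)%:R - h * q i k| <= e * h.
Proof.
move=> e0; elim: s => [|k s [d d0 IH]]; first by exists 1.
have /cvgrPdist_le /(_ e e0) := @hpq i k.
move=> [d' /= d'0 H].
exists (Num.min d d'); first by rewrite lt_min d0.
move=> h /andP[h0]; rewrite lt_min => /andP[hd hd'] k'; rewrite inE.
move=> /orP[/eqP ->|]; last by apply: IH; rewrite h0.
have /= := H h; rewrite sub0r normrN gtr0_norm// => /(_ hd' h0) Hh.
have -> : p h i k - (i == k)%:R - h * q i k =
   - h * (q i k - (p h i k - (i == k)%:R) / h) by field; rewrite gt_eqF.
by rewrite normrM normrN (gtr0_norm h0) [leRHS]mulrC ler_wpM2l// ltW.
Qed.

(** A quantitative Fatou lemma.  Only finitely many targets are kept, on which the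
difference quotients of [p] are uniformly close to [q]; the discarded terms are
nonnegative. *)
Lemma average_lower i e : 0 < e -> exists2 d, 0 < d &
  forall h, 0 < h < d -> forall F, (forall k, 0 <= F k <= 1) ->
    F i + h * generator q F i - e * h <= average p F h i.
Proof.
move=> e0.
have e20 : 0 < e / 2 by rewrite divr_gt0.
have [X [iX HX]] := jump_approx hq i e20.
pose n := (size (i |` X)%fset)%:R : R.
have n0 : 0 <= n by rewrite ler0n.
(* Half of e pays for the targets outside X, the other half for the n
   targets kept, each with error eta. *)
pose eta := e / 2 / (n + 1).
have eta0 : 0 < eta by rewrite divr_gt0// ltr_wpDl.
have [d d0 Hd] := trans_small_time i (i |` X)%fset eta0.
exists d => // h hd F F01; have h0 : 0 < h by case/andP: hd.
have F0 k : 0 <= F k by case/andP: (F01 k).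
have F1 k : F k <= 1 by case/andP: (F01 k).
have pF0 k : setT k -> 0 <= p h i k * F k by rewrite mulr_ge0// (trans_ge0 hp)// ltW.
have sF := average_summable i (ltW h0) F01.
apply: le_trans (rsum_ge_fset pF0 sF (@subsetT _ [set` (i |` X)%fset])).
apply: (@le_trans _ _ (\sum_(k <- (i |` X)%fset) (((i == k)%:R + h * q i k) * F k - eta * h))).
  rewrite sumrB big_const_seq count_predT iter_addr_0 -[_ *+ _]mulr_natl.
  have -> : (size (i |` X)%fset)%:R = n by [].
  rewrite big_fsetU1//= eqxx.
  have -> : \sum_(k <- X) ((i == k)%:R + h * q i k) * F k = h * \sum_(k <- X) q i k * F k.
    rewrite mulr_sumr big_seq [RHS]big_seq; apply: eq_bigr => k kX.
    case: eqP => [ik|_]; first by move: iX; rewrite ik kX.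
    by rewrite add0r mulrA.
  have H1 : n * (eta * h) <= e / 2 * h.
    rewrite mulrA ler_wpM2r ?(ltW h0)// /eta mulrA ler_pdivrMr ?ltr_wpDl//.
    by rewrite mulrDr mulr1 mulrC lerDl ltW.
  have := HX F F01; rewrite /generator => H2.
  have : h * (jump q F i) <= h * (\sum_(k <- X) q i k * F k + e / 2) by rewrite ler_wpM2l// ltW.
  move: H1; move: (\sum_(k <- X) q i k * F k) (jump q F i) (n * (eta * h)) => x y z ? ?.
  rewrite (_ : true%:R = 1 :> R)//; lra.
rewrite big_seq [leRHS]big_seq; apply: ler_sum => k kX.
have := Hd h hd k kX; rewrite ler_norml => /andP[+ _].
have eh : 0 <= eta * h by rewrite mulr_ge0// ltW.
have := ler_wpM2l eh (F1 k) => H1 H2.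
have : 0 <= (eta * h + (p h i k - (i == k)%:R - h * q i k)) * F k.
  by rewrite mulr_ge0//; lra.
rewrite !mulrDl !mulNr; lra.
Qed.

(** The upper bound is [average_lower] for [1 - F], because the rows of [p] have
mass at most 1. *)
Lemma average_small_time i e : 0 < e -> exists2 d, 0 < d &
  forall h, 0 < h < d -> forall F, (forall k, 0 <= F k <= 1) ->
    `|average p F h i - F i - h * generator q F i| <= e * h.
Proof.
move=> e0; have [d d0 Hd] := average_lower i e0; exists d => // h hd F F01.
have h0 : 0 < h by case/andP: hd.
have F01' k : 0 <= 1 - F k <= 1 by case/andP: (F01 k) => ? ?; apply/andP; split; lra.
rewrite ler_norml; apply/andP; split; first by have := Hd h hd F F01; lra.
have := Hd h hd _ F01'; rewrite /generator jump_compl//.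
have := average_compl i (ltW h0) F01; lra.
Qed.

End SmallTime.

(** * Bounded solutions of the backward equation *)

Definition continuous_nonneg (R : realType) (f : R -> R) : Prop :=
  forall t e, 0 <= t -> 0 < e -> exists2 d, 0 < d &
    forall s, 0 <= s -> `|s - t| < d -> `|f s - f t| <= e.

(** A function that starts nonpositive and cannot increase while nonnegative stays
nonpositive.  Asking for the Dini condition only where [f] is nonnegative lets
the damping term of the generator be used in [compare_step]. *)
Lemma dini_le0 (R : realType) (f : R -> R) :
  continuous_nonneg f -> f 0 <= 0 ->
  (forall t e, 0 <= t -> 0 <= f t -> 0 < e -> exists2 d, 0 < d &
     forall h, 0 < h < d -> f (t + h) <= f t + e * h) ->
  forall t, 0 <= t -> f t <= 0.
Proof.
move=> cf f0 df.
suff H e : 0 < e -> forall t, 0 <= t -> f t <= e * (1 + t).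
  move=> t t0; apply/ler_addgt0Pr => e e0; rewrite add0r.
  have t1 : 0 < 1 + t by rewrite ltr_wpDr.
  have := H (e / (1 + t)) (divr_gt0 e0 t1) t t0.
  by rewrite divfK// gt_eqF.
move=> e0 T T0; rewrite leNgt; apply/negP => fT.
(* Compare f with the strictly increasing barrier e (1 + t): the supremum
   of the times up to which f stays below the barrier is at least T. *)
pose A := [set t : R | 0 <= t <= T /\ forall s, 0 <= s <= t -> f s <= e * (1 + s)].
have A0 : A 0.
  split; first by rewrite lexx.
  move=> s /andP[s0 s1]; have -> : s = 0 by apply/eqP; rewrite eq_le s0 s1.
  by rewrite addr0 mulr1 (le_trans f0) ?ltW.
have ubA : ubound A T by move=> t [/andP[]].
have supA1 : A !=set0 by exists 0.
have supA2 : has_ubound A by exists T.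
pose tau := sup A.
have tau0 : 0 <= tau by have := ub_le_sup supA2 A0.
have tauT : tau <= T by exact: ge_sup supA1 ubA.
have below s : 0 <= s < tau -> f s <= e * (1 + s).
  move=> /andP[s0 st].
  have [a [_ Ha] sa] := sup_gt supA1 st.
  by apply: Ha; rewrite s0 ltW.
have ftau : f tau <= e * (1 + tau).
  rewrite leNgt; apply/negP => ft.
  have eta0 : 0 < (f tau - e * (1 + tau)) / 2 by rewrite divr_gt0// subr_gt0.
  have [d d0 Hd] := cf tau _ tau0 eta0.
  have taup : 0 < tau.
    rewrite lt_neqAle tau0 andbT; apply/eqP => t0.
    by move: ft; rewrite -t0 addr0 mulr1 ltNge (le_trans f0)// ltW.
  pose s := Num.max 0 (tau - d / 2).
  have s0 : 0 <= s by rewrite le_max lexx.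
  have st : s < tau by rewrite gt_max taup gtrBl divr_gt0.
  have ds : tau - d / 2 <= s by rewrite le_max lexx orbT.
  have dst : `|s - tau| < d by rewrite ler0_norm; lra.
  have := Hd s s0 dst; rewrite ler_norml => /andP[H1 _].
  have := below s; rewrite s0 st => /(_ isT) H2.
  have : e * s <= e * tau by rewrite ler_wpM2l// ltW.
  move: H1 H2 ft; rewrite !mulrDr !mulr1; lra.
have Atau : A tau.
  split; first by rewrite tau0.
  move=> s /andP[s0]; rewrite le_eqVlt => /orP[/eqP ->//|st].
  by apply: below; rewrite s0.
have tT : tau < T.
  rewrite lt_neqAle tauT andbT; apply/eqP => tT.
  by move: ftau; rewrite tT leNgt fT.
have [d d0 Hd] : exists2 d, 0 < d & forall h, 0 < h < d -> f (tau + h) <= e * (1 + (tau + h)).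
  have [ft0|ft0] := leP 0 (f tau).
    have [d d0 Hd] := df tau e tau0 ft0 e0; exists d => // h /Hd.
    by move: ftau; rewrite !mulrDr; lra.
  have [d d0 Hd] := cf tau e tau0 e0; exists d => // h /andP[h0 hd].
  have := Hd (tau + h); rewrite addr_ge0// ?(ltW h0)// => /(_ isT).
  rewrite addrAC subrr add0r (gtr0_norm h0) => /(_ hd).
  rewrite ler_norml => /andP[_ H1].
  have : 0 <= e * (tau + h) by rewrite mulr_ge0 ?addr_ge0// ltW.
  by rewrite [e * (1 + _)]mulrDr mulr1; lra.
pose r := Num.min (tau + d / 2) T.
have d20 : 0 < d / 2 by rewrite divr_gt0.
have tr : tau < r by rewrite lt_min tT andbT ltrDl.
suff Ar : A r by have := ub_le_sup supA2 Ar; rewrite leNgt tr.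
split; first by rewrite ge_min lexx orbT andbT (le_trans tau0)// ltW.
move=> s /andP[s0 sr]; have [st|ts] := leP s tau; first by apply: (proj2 Atau); rewrite s0.
have : s <= tau + d / 2 by move: sr; rewrite le_min => /andP[].
move=> sd; have := Hd (s - tau); rewrite (addrC tau) subrK; apply.
by apply/andP; split; lra.
Qed.

(** Right derivatives are enough for the comparison argument, and they are what
the semigroup property yields directly. *)
Record backward_solution (R : realType) (S : countType) (q : S -> S -> R)
    (W : R -> S -> R) : Prop := {
  backward_range : forall t i, 0 <= t -> 0 <= W t i <= 1;
  backward_cont : forall i, continuous_nonneg (W ^~ i);
  backward_deriv : forall t i e, 0 <= t -> 0 < e -> exists2 d, 0 < d &
    forall h, 0 < h < d ->
      `|W (t + h) i - W t i - h * generator q (W t) i| <= e * h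
}.

Section TransitionSolution.
Variables (R : realType) (S : countType) (q : S -> S -> R) (p : R -> S -> S -> R).
Hypotheses (hq : conservative q) (hp : transition_function p) (hpq : has_Qmatrix p q).

Lemma average_range t i F : 0 <= t -> (forall k, 0 <= F k <= 1) ->
  0 <= average p F t i <= 1.
Proof.
move=> t0 F01; apply/andP; split.
  by apply: rsum_ge0 => k _; rewrite mulr_ge0 ?(trans_ge0 hp)//; case/andP: (F01 k).
apply: le_trans (trans_sum_le1 hp i t0); apply: rsum_le; last exact: (trans_summable hp).
move=> k _; case/andP: (F01 k) => ? ?.
by rewrite mulr_ge0 ?(trans_ge0 hp)//= ler_piMr ?(trans_ge0 hp).
Qed.

(** Chapman-Kolmogorov summed against [F], by exchanging the two sums. *)
Lemma average_semigroup s t i F : 0 <= s -> 0 <= t -> (forall k, 0 <= F k <= 1) ->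
  average p F (s + t) i = average p (average p F t) s i.
Proof.
move=> s0 t0 F01.
have p0 r j k : 0 <= r -> 0 <= p r j k by move=> ?; exact: (trans_ge0 hp).
have F0 k : 0 <= F k by case/andP: (F01 k).
have st0 : 0 <= s + t by rewrite addr_ge0.
have avgE r j G : 0 <= r -> (forall k, 0 <= G k <= 1) ->
    ((average p G r j)%:E = \esum_(k in setT) (p r j k * G k)%:E)%E.
  move=> r0 G01; rewrite -esum_rsum//; last exact: (average_summable hp).
  by move=> k _; rewrite mulr_ge0 ?p0//; case/andP: (G01 k).
have A01 k : 0 <= average p F t k <= 1 by exact: average_range.
apply: EFin_inj; rewrite !avgE//.
transitivity (\esum_(j in setT) \esum_(k in setT) (p s i k * p t k j * F j)%:E)%E.
  apply: eq_esum => j _.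
  rewrite mulrC EFinM -(trans_CK hp)// -esum_scale//; last by move=> k _; rewrite mulr_ge0 ?p0.
  by apply: eq_esum => k _; rewrite mulrC.
transitivity (\esum_(k in setT) \esum_(j in setT) (p s i k * p t k j * F j)%:E)%E.
  rewrite esum_esum; last by move=> j k _ _; rewrite lee_fin !mulr_ge0 ?p0.
  rewrite esum_esum; last by move=> j k _ _; rewrite lee_fin !mulr_ge0 ?p0.
  apply: (reindex_esum _ _ (fun x : S * S => (x.2, x.1))).
  - split=> //; first by move=> [? ?] [? ?] _ _ [-> ->].
    by move=> [x y] _; exists (y, x).
apply: eq_esum => k _.
rewrite EFinM avgE//.
rewrite -esum_scale ?p0//; last by move=> j _; rewrite mulr_ge0 ?p0.
by apply: eq_esum => j _; rewrite mulrA.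
Qed.

Lemma generator_bound i F : (forall k, 0 <= F k <= 1) ->
  `|generator q F i| <= - q i i.
Proof.
move=> F01.
have F0 k : 0 <= F k by case/andP: (F01 k).
have F1 k : F k <= 1 by case/andP: (F01 k).
have q0 : 0 <= - q i i.
  have [_ <-] := rsummableP (conservative_row hq i).
  by apply: rsum_ge0 => k; exact: (conservative_ge0 hq).
have J0 := jump_ge0 hq i F0.
have : 0 <= jump q (fun k => 1 - F k) i by apply: jump_ge0 => // k; rewrite subr_ge0.
rewrite jump_compl// => J1.
have H0 : 0 <= - q i i * F i by rewrite mulr_ge0.
have H1 : 0 <= - q i i * (1 - F i) by rewrite mulr_ge0// subr_ge0.
rewrite ler_norml /generator; apply/andP; split; nra.
Qed.

(** By the semigroup property, the value at time [t + h] is the average over time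
[h] of the function [average p F t].  This function has values in [0, 1], so the
uniform small-time estimate applies to it. *)
Lemma transition_backward F : (forall k, 0 <= F k <= 1) ->
  backward_solution q (average p F).
Proof.
move=> F01.
have r01 t k : 0 <= t -> 0 <= average p F t k <= 1 by move=> t0; exact: average_range.
have small t i e : 0 <= t -> 0 < e -> exists2 d, 0 < d & forall h, 0 < h < d ->
    `|average p F (t + h) i - average p F t i - h * generator q (average p F t) i| <= e * h.
  move=> t0 /(average_small_time hq hp hpq i)[d d0 Hd]; exists d => // h hd.
  have h0 : 0 <= h by case/andP: hd => /ltW.
  by rewrite (addrC t) average_semigroup//; apply: Hd => // k; exact: r01.
split=> //.
move=> i t e t0 e0.
have [d d0 Hd] := average_small_time hq hp hpq i ltr01.
pose M := 1 - q i i.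
have M0 : 0 < M.
  have /= := @generator_bound i (fun=> 0); rewrite lexx ler01 => /(_ (fun=> isT)) H.
  have := le_trans (normr_ge0 _) H; rewrite /M; lra.
have lip s h : 0 <= s -> 0 <= h < d -> `|average p F (s + h) i - average p F s i| <= M * h.
  move=> s0 /andP[]; rewrite le_eqVlt => /orP[/eqP<- _|h0 hd].
    by rewrite addr0 subrr normr0 mulr0.
  rewrite (addrC s) average_semigroup ?(ltW h0)//.
  have r01s k : 0 <= average p F s k <= 1 by exact: r01.
  have hd' : 0 < h < d by rewrite h0.
  have H1 := Hd h hd' _ r01s.
  have := generator_bound i r01s => H2.
  set a := average p _ h i in H1 *; set g := generator _ _ _ in H1 H2.
  have -> : a - average p F s i = (a - average p F s i - h * g) + h * g by rewrite subrK.
  rewrite (le_trans (ler_normD _ _))// normrM (gtr0_norm h0) /M.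
  have : h * `|g| <= h * - q i i by rewrite ler_wpM2l// ltW.
  by rewrite mulrBl; lra.
exists (Num.min d (e / M)); first by rewrite lt_min d0 divr_gt0.
move=> s s0; rewrite lt_min => /andP[sd se].
suff : `|average p F s i - average p F t i| <= M * `|s - t|.
  by move=> /le_trans; apply; rewrite mulrC -ler_pdivlMr// ltW.
have [st|ts] := leP s t.
  have st0 : 0 <= t - s by rewrite subr_ge0.
  rewrite distrC (distrC s t) (ger0_norm st0); rewrite distrC (ger0_norm st0) in sd.
  by have := @lip s (t - s) s0; rewrite st0 sd (addrC s) subrK => /(_ isT).
have st0 : 0 <= s - t by rewrite subr_ge0 ltW.
rewrite (ger0_norm st0); rewrite (ger0_norm st0) in sd.
by have := @lip t (s - t) t0; rewrite st0 sd (addrC t) subrK => /(_ isT).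
Qed.

Lemma average0 F i : (forall k, 0 <= F k) -> average p F 0 i = F i.
Proof.
move=> F0; apply: EFin_inj; rewrite /average /rsum.
rewrite (esumID [set i])//; last first.
  by move=> k _; rewrite lee_fin mulr_ge0// (trans_ge0 hp).
rewrite setTI esum_set1; last by rewrite lee_fin mulr_ge0// (trans_ge0 hp).
rewrite esum1 ?adde0 ?(trans_0 hp) ?eqxx ?mul1r//.
by move=> k [_ /= /eqP]; rewrite eq_sym (trans_0 hp) => /negPf ->; rewrite mul0r.
Qed.

End TransitionSolution.

(** * Uniqueness under a Lyapunov function *)

Record lyapunov (R : realType) (S : countType) (q : S -> S -> R) (V : S -> R)
    (c L : R) : Prop := {
  lyapunov_ge1 : forall i, 1 <= V i;
  lyapunov_rate : forall i, - q i i <= L * V i;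
  lyapunov_summable : forall i, rsummable [set k | k != i] (fun k => q i k * V k);
  lyapunov_drift : forall i, jump q V i <= (c - q i i) * V i
}.

Section Uniqueness.
Variables (R : realType) (S : countType) (q : S -> S -> R) (V : S -> R) (c L : R).
Hypotheses (hq : conservative q) (hV : lyapunov q V c L) (c0 : 0 <= c) (L0 : 0 <= L).
Variables (W W' : R -> S -> R).
Hypotheses (hW : backward_solution q W) (hW' : backward_solution q W').
Hypothesis init_le : forall i, W 0 i <= W' 0 i.

Definition dominated (K : R) : Prop := forall t i, 0 <= t ->
  W t i <= W' t i + K * V i * expR ((c + 1) * t).

Let V0 i : 0 < V i. Proof. exact: lt_le_trans ltr01 (lyapunov_ge1 hV i). Qed.

Lemma exit_rate_ge0 i : 0 <= - q i i.
Proof.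
have [_ <-] := rsummableP (conservative_row hq i).
by apply: rsum_ge0 => k; exact: (conservative_ge0 hq).
Qed.

Lemma jump_dominated K t i : 0 <= K -> 0 <= t -> dominated K ->
  jump q (W t) i <= jump q (W' t) i + K * expR ((c + 1) * t) * jump q V i.
Proof.
move=> K0 t0 HK.
have KE0 : 0 <= K * expR ((c + 1) * t) by rewrite mulr_ge0// expR_ge0.
have q0 k : k != i -> 0 <= q i k by exact: (conservative_ge0 hq).
have W0 k : 0 <= W t k by case/andP: (backward_range hW k t0).
have W0' k : 0 <= W' t k by case/andP: (backward_range hW' k t0).
have W1' k : W' t k <= 1 by case/andP: (backward_range hW' k t0).
have sV := lyapunov_summable hV i.
have sW := jump_summable hq i W1'.
have qV0 k : k != i -> 0 <= q i k * V k by move=> ki; rewrite mulr_ge0 ?q0// ltW.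
rewrite /jump -rsumZ// -rsumD//; last 3 first.
- by move=> k ki; rewrite mulr_ge0 ?q0.
- by move=> k ki; rewrite mulr_ge0// mulr_ge0 ?q0// ltW.
- exact: rsummableZ.
apply: rsum_le.
  move=> k ki; rewrite mulr_ge0 ?q0//=.
  have := HK t k t0 => H; have := ler_wpM2l (q0 k ki) H.
  by rewrite mulrDr => /le_trans; apply; rewrite lerD2l le_eqVlt; apply/orP; left; apply/eqP; ring.
apply: rsummableD => //.
- by move=> k ki; rewrite mulr_ge0 ?q0.
- by move=> k ki; rewrite mulr_ge0// mulr_ge0 ?q0// ltW.
- exact: rsummableZ.
Qed.

(** If the difference of the solutions is at most [K V e^((c+1)t)], the jump part of
its derivative at [i] is at most [K (c - q i i) V i e^((c+1)t)], while the diagonal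
part damps it at rate [- q i i].  The function [th K V i e^((c+1)t)] needs a jump
part of [th K (c + 1 - q i i) V i e^((c+1)t)] to solve the damped equation, so it
is a barrier as soon as [c - q i i <= th (c + 1 - q i i)]. *)
Lemma compare_step K th i t : 0 <= K -> dominated K ->
  c - q i i <= th * (c + 1 - q i i) -> 0 <= t ->
  W t i <= W' t i + th * K * V i * expR ((c + 1) * t).
Proof.
move=> K0 HK Hth.
have qi0 := exit_rate_ge0 i.
have c0' := c0.
pose B := th * K * V i.
have th0 : 0 <= th.
  rewrite leNgt; apply/negP => th0.
  have : th * (c + 1 - q i i) < 0 by rewrite nmulr_rlt0//; lra.
  by lra.
have B0 : 0 <= B by rewrite !mulr_ge0// ltW.
pose f t := W t i - W' t i - B * expR ((c + 1) * t).
suff : forall t, 0 <= t -> f t <= 0.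
  by move=> H t0; have := H t t0; rewrite /f /B; lra.
apply: dini_le0.
- move=> s e s0 e0.
  have e30 : 0 < e / 3 by rewrite divr_gt0.
  have [d1 d10 H1] := backward_cont hW i s0 e30.
  have [d2 d20 H2] := backward_cont hW' i s0 e30.
  have : {for s, continuous (fun t => B * expR ((c + 1) * t))}.
    apply: continuousM; first exact: cst_continuous.
    apply: continuous_comp; last exact: continuous_expR.
    by apply: continuousM; [exact: cst_continuous|exact: cvg_id].
  move=> /cvgrPdist_le /(_ _ e30) [d3 /= d30 H3].
  exists (Num.min d1 (Num.min d2 d3)); first by rewrite !lt_min d10 d20.
  move=> r r0; rewrite !lt_min => /and3P[h1 h2 h3].
  have := H1 r r0 h1; have := H2 r r0 h2; have := H3 r; rewrite /= distrC => /(_ h3).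
  rewrite /f !ler_norml => /andP[? ?] /andP[? ?] /andP[? ?].
  by apply/andP; split; lra.
- by rewrite /f mulr0 expR0 mulr1; have := init_le i; lra.
move=> s e s0 fs e0.
have e20 : 0 < e / 2 by rewrite divr_gt0.
have [d1 d10 H1] := backward_deriv hW i s0 e20.
have [d2 d20 H2] := backward_deriv hW' i s0 e20.
exists (Num.min d1 d2); first by rewrite lt_min d10.
move=> h /andP[h0]; rewrite lt_min => /andP[h1 h2].
have {}H1 := H1 h; rewrite h0 h1 in H1; have := H1 isT; rewrite ler_norml => /andP[_ {}H1].
have {}H2 := H2 h; rewrite h0 h2 in H2; have := H2 isT; rewrite ler_norml => /andP[{}H2 _].
set E := expR ((c + 1) * s).
have E0 : 0 <= E by exact: expR_ge0.
have HE : B * E * (1 + (c + 1) * h) <= B * expR ((c + 1) * (s + h)).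
  rewrite -mulrA ler_wpM2l// [in leRHS]mulrDr expRD ler_wpM2l//.
  exact: expR_ge1Dx.
have Hj := jump_dominated i K0 s0 HK.
have Hd : K * E * jump q V i <= B * E * (c + 1 - q i i).
  have := lyapunov_drift hV i => Hdr.
  have KE0 : 0 <= K * E by rewrite mulr_ge0.
  apply: (le_trans (ler_wpM2l KE0 Hdr)).
  have := ler_wpM2l (mulr_ge0 KE0 (ltW (V0 i))) Hth.
  rewrite /B => ?.
  have -> : K * E * ((c - q i i) * V i) = K * E * V i * (c - q i i) by ring.
  have -> : th * K * V i * E * (c + 1 - q i i) = K * E * V i * (th * (c + 1 - q i i)) by ring.
  done.
have Hg : generator q (W s) i - generator q (W' s) i <= B * E * (c + 1).
  rewrite /generator.
  have : 0 <= - q i i * (W s i - W' s i - B * E) by rewrite mulr_ge0.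
  by move: Hj Hd; rewrite -/E; lra.
have := ler_wpM2l (ltW h0) Hg.
rewrite /f -/E; lra.
Qed.

(** On the states with [V <= N] the exit rates are bounded, so a single factor
[th < 1] improves the constant there; on the others the difference of two
functions with values in [0, 1] is at most [V / N]. *)
Lemma backward_le t i : 0 <= t -> W t i <= W' t i.
Proof.
have W1 s k : 0 <= s -> W s k <= 1 by move=> s0; case/andP: (backward_range hW k s0).
have W0 s k : 0 <= s -> 0 <= W' s k by move=> s0; case/andP: (backward_range hW' k s0).
have E1 s : 0 <= s -> 1 <= expR ((c + 1) * s).
  by move=> s0; rewrite -expR0 ler_expR mulr_ge0// addr_ge0.
suff H N : 1 <= N -> dominated N^-1.
  move=> t0; apply/ler_addgt0Pr => e e0.
  pose a := V i * expR ((c + 1) * t).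
  have a0 : 0 < a by rewrite mulr_gt0// expR_gt0.
  (* With this N the bound V e^((c+1)t) / N at the given t and i is at most e. *)
  pose N := Num.max 1 (a / e).
  have N1 : 1 <= N by rewrite le_max lexx.
  have N0 : 0 < N by rewrite (lt_le_trans ltr01).
  have aN : a / e <= N by rewrite le_max lexx orbT.
  apply: (le_trans (H N N1 t i t0)); rewrite lerD2l -mulrA -/a.
  by rewrite mulrC ler_pdivrMr// mulrC -ler_pdivrMr.
move=> N1.
have N0 : 0 < N by rewrite (lt_le_trans ltr01).
have c0' := c0.
pose th := (c + L * N) / (c + L * N + 1).
have LN0 : 0 <= L * N by rewrite mulr_ge0// ltW.
have den0 : 0 < c + L * N + 1 by lra.
have th0 : 0 <= th by rewrite divr_ge0//; lra.
have th1 : th < 1 by rewrite ltr_pdivrMr// mul1r ltrDl.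
have far K : dominated K -> 0 <= K -> dominated (Num.max (th * K) N^-1).
  move=> HK K0 s k s0.
  have [VN|VN] := leP (V k) N.
    apply: le_trans (@compare_step K th k s K0 HK _ s0) _.
      rewrite /th mulrAC ler_pdivlMr//.
      have := lyapunov_rate hV k.
      have : L * V k <= L * N by rewrite ler_wpM2l.
      have := exit_rate_ge0 k.
      nra.
    by rewrite lerD2l ler_wpM2r ?expR_ge0// ler_wpM2r ?(ltW (V0 k))// le_max lexx.
  apply: (le_trans (W1 s k s0)).
  rewrite -[leLHS]add0r lerD ?W0//.
  have : 1 <= N^-1 * V k by rewrite mulrC ler_pdivlMr// mul1r ltW.
  have : N^-1 * V k <= Num.max (th * K) N^-1 * V k.
    by rewrite ler_wpM2r ?(ltW (V0 k))// le_max lexx orbT.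
  have := E1 s s0 => H1 H2 H3.
  by rewrite mulr_ege1// (le_trans H3).
have dom n : dominated (Num.max (th ^+ n) N^-1).
  elim: n => [|n IH].
    rewrite expr0 => s k s0; apply: (le_trans (W1 s k s0)).
    rewrite -[leLHS]add0r lerD ?W0//.
    have H1 : 1 <= Num.max 1 N^-1 by rewrite le_max lexx.
    by rewrite !mulr_ege1 ?(lyapunov_ge1 hV) ?E1.
  have m0 : 0 <= Num.max (th ^+ n) N^-1 by rewrite le_max invr_ge0 (ltW N0) orbT.
  move=> s k s0; apply: (le_trans (far _ IH m0 s k s0)).
  rewrite lerD2l ler_wpM2r ?expR_ge0// ler_wpM2r ?(ltW (V0 k))//.
  rewrite maxr_pMr// -exprS ge_max; apply/andP; split; last by rewrite le_max lexx orbT.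
  rewrite ge_max le_max lexx /= le_max; apply/orP; right.
  by rewrite ler_piMl ?invr_ge0 ?(ltW N0)// ltW.
have [n Hn] : exists n, th ^+ n <= N^-1.
  have Ni0 : 0 < N^-1 by rewrite invr_gt0.
  have th1' : `|th| < 1 by rewrite ger0_norm.
  have /cvgrPdist_le /(_ _ Ni0) [n _ Hn] := cvg_expr th1'.
  exists n; have := Hn n (leqnn n).
  by rewrite sub0r normrN ger0_norm// exprn_ge0.
by have := dom n; rewrite (max_idPr Hn).
Qed.

End Uniqueness.

Theorem backward_unique (R : realType) (S : countType) (q : S -> S -> R)
    (V : S -> R) (c L : R) (W W' : R -> S -> R) :
  conservative q -> lyapunov q V c L -> 0 <= c -> 0 <= L ->
  backward_solution q W -> backward_solution q W' -> (forall i, W 0 i = W' 0 i) ->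
  forall t i, 0 <= t -> W t i = W' t i.
Proof.
move=> hq hV c0 L0 hW hW' h0 t i t0; apply/eqP; rewrite eq_le.
by rewrite !(backward_le hq hV c0 L0)// => k; rewrite h0.
Qed.

(** * Jumps of the branching process with counts *)

Lemma I2_ind (P : 'I_2 -> Prop) : P 0 -> P 1 -> forall a, P a.
Proof.
move=> P0 P1 a; case: (unliftP 0 a) => [c ->|-> //].
by rewrite (_ : lift 0 c = 1)//; apply/val_inj; rewrite (ord1 c).
Qed.

Lemma sum_I2 (V : nmodType) (F : 'I_2 -> V) : \sum_a F a = F 0 + F 1.
Proof.
rewrite big_ord_recl big_ord1; congr (_ + F _); exact/val_inj.
Qed.

Lemma zvec_inj : injective zvec.
Proof. by move=> j j' /ffunP e; apply/ffunP => a; have := e a; rewrite !ffunE => -[]. Qed.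

Lemma zrate_zvec (R : realType) (b : 'I_2 -> vec -> R) a j : zrate b a (zvec j) = b a j.
Proof.
rewrite /zrate ifT; last by apply/forallP => c; rewrite ffunE.
by congr (b a); apply/ffunP => c; rewrite !ffunE.
Qed.

Section Branching.
Variables (R : realType) (b : 'I_2 -> vec -> R) (R1 R2 : {fset vec}).
Notation state := (bstate R1 R2).
Hypotheses (hb : offspring_rates b) (hR1 : unitv 0 \notin R1) (hR2 : unitv 1 \notin R2).

Definition displacement (a : 'I_2) (s s' : state) : {ffun 'I_2 -> int} :=
  zvec s'.1.1 - zvec s.1.1 + zvec (unitv a).

Definition count1 (a : 'I_2) (l : {ffun R1 -> nat}) m : {ffun R1 -> nat} :=
  if a == 0 then addc l (mark R1 m) else l.

Definition count2 (a : 'I_2) (l : {ffun R2 -> nat}) m : {ffun R2 -> nat} :=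
  if a == 1 then addc l (mark R2 m) else l.

(** The type-[a] summand of the Q-matrix, per individual of type [a]. *)
Definition split_rate (a : 'I_2) (s s' : state) : R :=
  zrate b a (displacement a s s') *
  ((s'.1.2 == count1 a s.1.2 (displacement a s s')) &&
   (s'.2 == count2 a s.2 (displacement a s s')))%:R.

(** The subtraction is truncated, so this is the state after a split only when
[s] has an individual of type [a]. *)
Definition split_state (a : 'I_2) (s : state) (j : vec) : state :=
  ([ffun c => (s.1.1 c - (c == a) + j c)%N],
   count1 a s.1.2 (zvec j), count2 a s.2 (zvec j)).

Lemma birth_QE s s' : birth_Q b s s' = \sum_a (s.1.1 a)%:R * split_rate a s s'.
Proof. by case: s s' => [[i k] k'] [[j l] l']; rewrite sum_I2 /split_rate /= !mulrA. Qed.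

Lemma displacement_split a (s : state) j : (0 < s.1.1 a)%N ->
  displacement a s (split_state a s j) = zvec j.
Proof.
move=> sa; apply/ffunP => c; rewrite !ffunE.
case: eqP => [->|_] /=; last by rewrite subn0 PoszD; ring.
by rewrite /=; move: (s.1.1 a) sa (j a) => n n0 m; lia.
Qed.

Lemma split_rate_state a (s : state) j : (0 < s.1.1 a)%N ->
  split_rate a s (split_state a s j) = b a j.
Proof.
by move=> sa; rewrite /split_rate displacement_split// !eqxx mulr1 zrate_zvec.
Qed.

Lemma split_state_inj a (s : state) : injective (split_state a s).
Proof.
move=> j j' [/ffunP e _ _]; apply/ffunP => c; have := e c; rewrite !ffunE.
exact: addnI.
Qed.

Lemma split_rate_neq0 a (s s' : state) : (0 < s.1.1 a)%N -> split_rate a s s' != 0 ->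
  exists j, s' = split_state a s j.
Proof.
move=> sa; rewrite /split_rate mulf_eq0 negb_or => /andP[].
rewrite /zrate; case: ifP => [/forallP m0 _|_]; last by rewrite eqxx.
set m := displacement a s s' in m0 *.
pose j : vec := [ffun c => `|m c|%N].
have jm : zvec j = m.
  by apply/ffunP => c; rewrite [LHS]ffunE /j ffunE gez0_abs//; exact: m0.
case: (boolP (_ && _)) => [/andP[/eqP e1 /eqP e2] _|]; last by rewrite eqxx.
exists j; rewrite /split_state jm -e1 -e2.
rewrite [LHS]surjective_pairing [s'.1 in LHS]surjective_pairing; congr (_, _, _).
apply/ffunP => c; rewrite ffunE.
have := congr1 (fun f : {ffun 'I_2 -> int} => f c) jm.
rewrite ffunE; move: (j c) => jc; rewrite /m /displacement !ffunE => e.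
move: e; case: eqP => [->|_] /= e.
  by move: (s'.1.1 a) (s.1.1 a) sa e => x y; lia.
by move: (s'.1.1 c) (s.1.1 c) e => x y; lia.
Qed.

Lemma split_state_eq a (s : state) j : (0 < s.1.1 a)%N -> split_state a s j = s -> j = unitv a.
Proof.
move=> sa; move: (displacement_split j sa) => + e; rewrite e => d.
by apply: zvec_inj; rewrite -d /displacement subrr add0r.
Qed.

Lemma addc_mark_unit a (A : {fset vec}) l : unitv a \notin A ->
  addc l (mark A (zvec (unitv a))) = l.
Proof.
move=> uA; apply/ffunP => j; rewrite !ffunE.
case: eqP => [/zvec_inj ju|_]; last by rewrite addn0.
by move: uA; rewrite -ju fsvalP.
Qed.

Lemma count1_unit a l : count1 a l (zvec (unitv a)) = l.
Proof. by rewrite /count1; case: eqP => // ->; exact: addc_mark_unit. Qed.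

Lemma count2_unit a l : count2 a l (zvec (unitv a)) = l.
Proof. by rewrite /count2; case: eqP => // ->; exact: addc_mark_unit. Qed.

Lemma split_rate_diag a (s : state) : split_rate a s s = b a (unitv a).
Proof.
rewrite /split_rate /displacement subrr add0r zrate_zvec.
by rewrite count1_unit count2_unit !eqxx mulr1.
Qed.

(** The split into [unitv a] changes nothing: it is the diagonal of the Q-matrix.
This requires that [unitv a] be unmarked. *)
Lemma split_state_unit a (s : state) : (0 < s.1.1 a)%N -> split_state a s (unitv a) = s.
Proof.
case: s => [[i l] l'] /= ia; rewrite /split_state count1_unit count2_unit /=.
by congr (_, _, _); apply/ffunP => c; rewrite !ffunE; case: eqP => [->|_] /=; lia.
Qed.

Lemma split_rate_ge0 a (s s' : state) : (0 < s.1.1 a)%N -> s' != s -> 0 <= split_rate a s s'.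
Proof.
move=> sa s's; have [->//|] := eqVneq (split_rate a s s') 0.
move=> /(split_rate_neq0 sa)[j e]; rewrite e split_rate_state//.
have [ju|ju] := eqVneq j (unitv a); last exact: (rate_ge0 hb).
by move: s's; rewrite e ju split_state_unit// eqxx.
Qed.

Lemma esum_split a (s : state) (F : state -> R) : (0 < s.1.1 a)%N -> (forall s', 0 <= F s') ->
  (\esum_(s' in [set s' | s' != s]) (split_rate a s s' * F s')%:E =
   \esum_(j in [set j | j != unitv a]) (b a j * F (split_state a s j))%:E)%E.
Proof.
move=> sa F0.
rewrite (esumID (range (split_state a s))); last first.
  by move=> s' s's; rewrite lee_fin mulr_ge0// split_rate_ge0.
rewrite [X in (_ + X)%E]esum1 ?adde0; last first.
  move=> s' [s's Ns']; have [->|] := eqVneq (split_rate a s s') 0; first by rewrite mul0r.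
  by move=> /(split_rate_neq0 sa)[j e]; case: Ns'; exists j.
rewrite (reindex_esum [set j | j != unitv a] _ (split_state a s)).
  by apply: eq_esum => j _; rewrite split_rate_state.
split.
- move=> j /= ju; split; last by exists j.
  by apply: contra_neq ju => /(split_state_eq sa).
- by move=> j j' _ _; exact: split_state_inj.
- move=> s' [/= s's [j _ e]]; exists j => //=.
  by apply: contra_neq s's => ju; rewrite -e ju split_state_unit.
Qed.

(** Distinct offspring vectors lead to distinct states, so the sum over target
states can be reindexed by type and offspring vector.  The two types may lead to
the same state, which is why they are separated before reindexing. *)
Lemma esum_birth (s : state) (F : state -> R) : (forall s', 0 <= F s') ->
  (\esum_(s' in [set s' | s' != s]) (birth_Q b s s' * F s')%:E =
   \sum_a (s.1.1 a)%:R%:E *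
     \esum_(j in [set j | j != unitv a]) (b a j * F (split_state a s j))%:E)%E.
Proof.
move=> F0.
have r0 a s' : s' != s -> 0 <= (s.1.1 a)%:R * split_rate a s s'.
  move=> s's; have [->|sa] := posnP (s.1.1 a); first by rewrite mul0r.
  by rewrite mulr_ge0// split_rate_ge0.
transitivity (\esum_(s' in [set s' | s' != s]) \sum_(a <- index_enum 'I_2)
    ((s.1.1 a)%:R * split_rate a s s' * F s')%:E)%E.
  by apply: eq_esum => s' _; rewrite birth_QE mulr_suml sumEFin.
rewrite esum_sum; last by move=> s' a s's _; rewrite lee_fin mulr_ge0// r0.
apply: eq_bigr => a _.
have [->|sa] := posnP (s.1.1 a).
  by rewrite mul0e esum1// => s' _; rewrite !mul0r.
rewrite -esum_split// -esum_scale//.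
  by apply: eq_esum => s' _; rewrite mulrA.
by move=> s' s's; rewrite mulr_ge0// split_rate_ge0.
Qed.

Lemma birth_conservative : conservative (@birth_Q R b R1 R2).
Proof.
split.
  move=> s s' s's; rewrite birth_QE; apply: sumr_ge0 => a _.
  have [->|sa] := posnP (s.1.1 a); first by rewrite mul0r.
  by rewrite mulr_ge0// split_rate_ge0.
move=> s; have := @esum_birth s (fun=> 1) (fun=> ler01).
under eq_esum do rewrite mulr1; move=> ->.
rewrite birth_QE -sumrN -sumEFin; apply: eq_bigr => a _.
under eq_esum do rewrite mulr1.
by rewrite (rate_diag hb) split_rate_diag -EFinM mulrN.
Qed.

Lemma jump_birth (s : state) (F : state -> R) : (forall s', 0 <= F s') ->
  (forall a, rsummable [set j | j != unitv a] (fun j => b a j * F (split_state a s j))) ->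
  rsummable [set s' | s' != s] (fun s' => birth_Q b s s' * F s') /\
  jump (@birth_Q R b R1 R2) F s =
   \sum_a (s.1.1 a)%:R *
     rsum [set j | j != unitv a] (fun j => b a j * F (split_state a s j)).
Proof.
move=> F0 sF; apply: rsummableP; rewrite esum_birth// -sumEFin; apply: eq_bigr => a _.
rewrite esum_rsum// => j ju; rewrite mulr_ge0//; exact: (rate_ge0 hb).
Qed.

End Branching.

(** * Offspring sums and first moments *)

Section SignedSum.
Variables (R : realType) (T : choiceType).

(** The offspring rates have exactly one nonpositive entry, so every signed sum in
the differential equation is a nonnegative sum plus one term. *)
Lemma csum_one_neg (A : set T) (f : T -> R) e : A e -> f e <= 0 ->
  (forall i, i != e -> 0 <= f i) ->
  csum A f = rsum (A `&` [set i | i != e]) f + f e.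
Proof.
move=> Ae fe f0; rewrite /csum.
have -> : (\esum_(i in A) ((EFin \o f)^\+ i) = \esum_(i in A `&` [set i | i != e]) (f i)%:E)%E.
  rewrite (esumID [set i | i != e]); last by move=> i _; rewrite funepos_ge0.
  rewrite [X in (_ + X)%E]esum1 ?adde0; last first.
    move=> i [_ /= /negP]; rewrite negbK => /eqP ->.
    by rewrite funeposE /= maxEge lee_fin leNgt; case: ltgtP fe => //= ->.
  apply: eq_esum => i [_ /= ie].
  by rewrite funeposE /= maxEge lee_fin f0.
have -> : (\esum_(i in A) ((EFin \o f)^\- i) = (- f e)%:E)%E.
  rewrite (esumID [set e]); last by move=> i _; rewrite funeneg_ge0.
  rewrite [X in (_ + X)%E]esum1 ?adde0; last first.
    move=> i [_ /= /eqP ie].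
    rewrite funenegE /= maxEge lee_fin oppr_ge0 leNgt.
    by have := f0 i ie; case: ltgtP => //= <-; rewrite ?oppr0.
  rewrite (_ : A `&` [set e] = [set e]); last by apply/seteqP; split=> [i []//|i /= ->].
  by rewrite esum_set1 ?funeneg_ge0// funenegE /= maxEge lee_fin oppr_ge0 fe.
by rewrite /= opprK.
Qed.

End SignedSum.

Lemma monom_unitv (R : realType) (x : 'I_2 -> R) a : monom x (unitv a) = x a.
Proof.
rewrite /monom (bigD1 a)//= ffunE eqxx expr1 big1 ?mulr1// => c /negPf ca.
by rewrite ffunE ca.
Qed.

(** The mark of a split into [j]: unmarked splits count as 1. *)
Definition weight (R : realType) (A : {fset vec}) (v : {ffun A -> R}) (j : vec) : R :=
  if insub j is Some m then v m else 1.

Definition offspring_sum (R : realType) (b : 'I_2 -> vec -> R) (a : 'I_2)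
    (F : vec -> R) : R :=
  rsum [set j | j != unitv a] (fun j => b a j * F j).

(** The right-hand side of the differential equation, with the splits of type [a]
into [j] weighted by [w a j]. *)
Definition vfield (R : realType) (b : 'I_2 -> vec -> R) (w : 'I_2 -> vec -> R)
    (a : 'I_2) (x : 'I_2 -> R) : R :=
  offspring_sum b a (fun j => monom x j * w a j) + b a (unitv a) * x a.

Section Offspring.
Variables (R : realType) (b : 'I_2 -> vec -> R).
Hypothesis hb : offspring_rates b.

Lemma offspring_summable a : rsummable [set j | j != unitv a] (b a).
Proof. by have [] := rsummableP (rate_diag hb a). Qed.

Lemma offspring_total a : rsum [set j | j != unitv a] (b a) = - b a (unitv a).
Proof. by have [] := rsummableP (rate_diag hb a). Qed.

Lemma rate_unit_le0 a : b a (unitv a) <= 0.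
Proof.
rewrite -oppr_ge0 -offspring_total; apply: rsum_ge0 => j; exact: (rate_ge0 hb).
Qed.

Lemma monom_ge0 (I : finType) (x : I -> R) j : in_cube x -> 0 <= monom x j.
Proof. by move=> x01; apply: prodr_ge0 => c _; rewrite exprn_ge0//; case/andP: (x01 c). Qed.

Lemma monom_le1 (I : finType) (x : I -> R) j : in_cube x -> monom x j <= 1.
Proof.
move=> x01; apply: prodr_ile1 => c _.
by case/andP: (x01 c) => x0 x1; rewrite exprn_ge0//= exprn_ile1.
Qed.

Lemma weight_range (A : {fset vec}) (v : {ffun A -> R}) j : in_cube v -> 0 <= weight v j <= 1.
Proof. by move=> v01; rewrite /weight; case: insub => [m|]; rewrite ?v01// ler01 lexx. Qed.

Lemma offspring_summable_le1 a F : (forall j, F j <= 1) ->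
  rsummable [set j | j != unitv a] (fun j => b a j * F j).
Proof.
move=> F1; apply: rsummable_le (offspring_summable a) => j ju.
by rewrite ler_piMr// (rate_ge0 hb).
Qed.

Lemma marked_unmarked a (A : {fset vec}) (v : {ffun A -> R}) (x : 'rV[R]_2) :
  unitv a \notin A -> in_cube (x 0) -> in_cube v ->
  markedB b a x v + unmarkedB b a A x =
  offspring_sum b a (fun j => monom (x 0) j * weight v j) + b a (unitv a) * x 0 a.
Proof.
move=> uA x01 v01.
rewrite /unmarkedB (@csum_one_neg _ _ _ _ (unitv a))//; first last.
- by move=> j ju; rewrite mulr_ge0 ?(rate_ge0 hb)// monom_ge0.
- by rewrite monom_unitv mulr_le0_ge0 ?rate_unit_le0//; case/andP: (x01 a).
rewrite monom_unitv addrA; congr (_ + _).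
have term0 j : j != unitv a -> 0 <= b a j * (monom (x 0) j * weight v j).
  move=> ju; have /andP[w0 _] := weight_range j v01.
  by rewrite mulr_ge0 ?(rate_ge0 hb)// mulr_ge0 ?monom_ge0.
apply: EFin_inj; rewrite EFinD -[RHS]esum_rsum//; last first.
  apply: offspring_summable_le1 => j; have /andP[w0 w1] := weight_range j v01.
  by rewrite mulr_ile1 ?monom_ge0 ?monom_le1.
rewrite (esumID [set` A]); last by move=> j ju; rewrite lee_fin term0.
congr (_ + _)%E.
  rewrite (_ : _ `&` _ = [set` A]); last first.
    apply/seteqP; split => [j []//|j /= jA]; split=> //=.
    by apply: contraNneq uA => <-.
  rewrite esum_fset//; last first.
    by move=> j; rewrite inE /= => jA; rewrite lee_fin term0//; apply: contraNneq uA => <-.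
  rewrite fsbig_finite// set_fsetK sumEFin; congr EFin.
  rewrite /markedB big_seq_fsetE; apply: eq_bigr => m _ /=.
  by rewrite /weight valK mulrA.
rewrite -esum_rsum; last 2 first.
- by move=> j [_ /= ju]; rewrite mulr_ge0 ?(rate_ge0 hb)// monom_ge0.
- apply: (@rsummable_sub _ _ _ [set j | j != unitv a]); first by move=> j [].
  by apply: offspring_summable_le1 => j; rewrite monom_le1.
rewrite setIC (_ : ~` [set` A] = [set j | j \notin A]).
  apply: eq_esum => j [_ /= /negPf jA].
  rewrite /weight insubF ?mulr1//.
by apply/seteqP; split => j /= /negP.
Qed.

Section Moments.
Hypothesis hA2 : assumption_A2 b.

Lemma genBE a (x : 'rV[R]_2) : in_cube (x 0) ->
  genB b a x = offspring_sum b a (monom (x 0)) + b a (unitv a) * x 0 a.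
Proof.
move=> x01; rewrite /genB (@csum_one_neg _ _ _ _ (unitv a))//.
- by rewrite setTI monom_unitv.
- by rewrite monom_unitv mulr_le0_ge0 ?rate_unit_le0//; case/andP: (x01 a).
- by move=> j ju; rewrite mulr_ge0 ?(rate_ge0 hb)// monom_ge0.
Qed.

(** A second-order Bernoulli inequality: the difference quotient of the [n]-th
power at 1 is [n] up to an error linear in the step. *)
Lemma one_sub_expr_ge n (s : R) : 0 <= s <= 1 ->
  s * (n%:R - n%:R ^+ 2 * s) <= 1 - (1 - s) ^+ n.
Proof.
move=> /andP[s0 s1]; elim: n => [|n IH]; first by rewrite expr0 expr0n mul0r subrr mulr0 subrr.
have := IH; rewrite [(1 - s) ^+ n.+1]exprS -natr1.
have : 0 <= n%:R :> R by [].
move: n%:R ((1 - s) ^+ n) => k z k0 {}IH.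
have s10 : 0 <= 1 - s by rewrite subr_ge0.
have := ler_wpM2l s10 IH.
have : 0 <= s ^+ 2 * (k ^+ 2 * s + k + 1).
  by rewrite mulr_ge0 ?sqr_ge0// !addr_ge0// mulr_ge0// sqr_ge0.
lra.
Qed.

Lemma monom_shift (c : 'I_2) (h : R) j :
  monom ((const_mx 1 + h *: delta_mx 0 c : 'rV[R]_2) 0) j = (1 + h) ^+ j c.
Proof.
rewrite /monom (bigD1 c)//= !mxE !eqxx mulr1 big1 ?mulr1// => a /negPf ac.
by rewrite !mxE eqxx ac mulr0 addr0 expr1n.
Qed.

Lemma shift_cube (c : 'I_2) (h : R) :
  in_cube ((const_mx 1 + h *: delta_mx 0 c : 'rV[R]_2) 0) <-> -1 <= h <= 0.
Proof.
split=> [/(_ c)|h01 a]; rewrite !mxE eqxx ?mulr1.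
  by rewrite eqxx mulr1 => /andP[? ?]; apply/andP; split; lra.
case: eqP => _; rewrite ?mulr1 ?mulr0 ?addr0 ?ler01 ?lexx//.
by case/andP: h01 => ? ?; apply/andP; split; lra.
Qed.

Lemma difference_quotient_ge a c s (X : {fset vec}) :
  0 < s <= 1 -> [set` X] `<=` [set j | j != unitv a] ->
  \sum_(j <- X) b a j * ((j c)%:R - (j c)%:R ^+ 2 * s) + b a (unitv a) <=
  (genB b a (const_mx 1 + (- s) *: delta_mx 0 c) - genB b a (const_mx 1)) / (- s).
Proof.
move=> /andP[s0 s1] XA.
have bu := rate_unit_le0 a.
have cu1 : in_cube ((const_mx 1 : 'rV[R]_2) 0) by move=> d; rewrite mxE ler01 lexx.
have cu : in_cube ((const_mx 1 + (- s) *: delta_mx 0 c : 'rV[R]_2) 0).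
  by apply/shift_cube; apply/andP; split; lra.
rewrite invrN mulrN -mulNr opprB ler_pdivlMr// !genBE//.
rewrite -!monom_unitv monom_shift.
have m1 j : monom ((const_mx 1 : 'rV[R]_2) 0) j = 1.
  by rewrite /monom big1// => d _; rewrite mxE expr1n.
have -> : offspring_sum b a (monom ((const_mx 1 : 'rV[R]_2) 0)) = - b a (unitv a).
  by rewrite -offspring_total; apply: eq_rsum => j _; rewrite m1 mulr1.
have -> : offspring_sum b a (monom ((const_mx 1 + - s *: delta_mx 0 c : 'rV[R]_2) 0)) =
          offspring_sum b a (fun j => (1 - s) ^+ j c).
  by apply: eq_rsum => j _; rewrite monom_shift.
rewrite m1.
have p0 n : 0 <= (1 - s) ^+ n by rewrite exprn_ge0// subr_ge0.
have p1 n : (1 - s) ^+ n <= 1 by rewrite exprn_ile1 ?subr_ge0// gerBl ltW.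
have : \sum_(j <- X) b a j * (1 - (1 - s) ^+ j c) <=
       - b a (unitv a) - offspring_sum b a (fun j => (1 - s) ^+ j c).
  have t0 j : j != unitv a -> 0 <= b a j * (1 - (1 - s) ^+ j c).
    by move=> ju; rewrite mulr_ge0 ?(rate_ge0 hb)// subr_ge0.
  have t1 : rsummable [set j | j != unitv a] (fun j => b a j * (1 - (1 - s) ^+ j c)).
    by apply: offspring_summable_le1 => j; rewrite gerBl.
  apply: (le_trans (rsum_ge_fset t0 t1 XA)).
  rewrite lerBrDr /offspring_sum -rsumD//; last 2 first.
  - by move=> j ju; rewrite mulr_ge0 ?(rate_ge0 hb).
  - exact: offspring_summable_le1.
  by rewrite -offspring_total le_eqVlt (eq_rsum (g := b a)) ?eqxx// => j _; ring.
have : (\sum_(j <- X) b a j * ((j c)%:R - (j c)%:R ^+ 2 * s)) * s <=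
       \sum_(j <- X) b a j * (1 - (1 - s) ^+ j c).
  rewrite mulr_suml big_seq [leRHS]big_seq; apply: ler_sum => j jX.
  rewrite -mulrA ler_wpM2l ?(rate_ge0 hb)//; first exact: XA.
  by rewrite mulrC one_sub_expr_ge// (ltW s0).
have : b a (unitv a) * s <= b a (unitv a) * (1 - (1 - s) ^+ (unitv a) c).
  rewrite ffunE; case: eqP => _ /=; first by rewrite expr1; lra.
  by rewrite expr0 subrr mulr0 mulr_le0_ge0// ltW.
move: (\sum_(j <- X) _) (\sum_(j <- X) _) (offspring_sum _ _ _) => x y z.
by rewrite mulrDl; lra.
Qed.

(** If the first moment were infinite, finite partial sums of it would bound the
difference quotients of the generating function from below by arbitrarily large
numbers, so the partial derivative at (1,1) would be infinite. *)
Lemma moment_summable a c : rsummable [set j | j != unitv a] (fun j => b a j * (j c)%:R).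
Proof.
have := hA2 a c; rewrite /rsummable /partialB.
move=> hlim; rewrite ltNge leye_eq; apply/negP => /eqP moo; move: hlim.
set D := within _ _.
have PD : ProperFilter D.
  (* The increments h allowed at (1,1) are those in [-1, 0], and 0 is one
     of their limit points. *)
  split; last exact: within_filter.
  move=> [e /= e0 H].
  pose h := - Num.min (e / 2) 1.
  have m0 : 0 < Num.min (e / 2) 1 by rewrite lt_min divr_gt0// ltr01.
  apply: (H h) => /=.
  - rewrite sub0r opprK gtr0_norm// gt_min; apply/orP; left.
    by rewrite ltr_pdivrMr// ltr_pMr// ltr1n.
  - by rewrite oppr_eq0 gt_eqF.
  - apply/shift_cube; rewrite lerNl opprK oppr_le0 (ltW m0) andbT.
    by rewrite ge_min lexx orbT.
suff hl : ((genB b a (const_mx 1 + h *: delta_mx 0 c) - genB b a (const_mx 1)) / h)%:E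
     @[h --> D] --> +oo%E by rewrite (cvg_lim (@ereal_hausdorff R) hl).
apply/cvgeryP/cvgryPge => M.
have q0 j : j != unitv a -> 0 <= b a j * (j c)%:R by move=> ju; rewrite mulr_ge0 ?(rate_ge0 hb).
have [X [XA HX]] : exists X : {fset vec}, [set` X] `<=` [set j | j != unitv a] /\
    M + 1 - b a (unitv a) <= \sum_(j <- X) b a j * (j c)%:R.
  have : ((M + 1 - b a (unitv a))%:E < \esum_(j in [set j | j != unitv a]) (b a j * (j c)%:R)%:E)%E.
    by rewrite moo ltry.
  move=> /ereal_sup_gt[_ [X [finX XA] <-]].
  rewrite fsbig_finite// sumEFin lte_fin => /ltW H.
  by exists (fset_set X); split=> // i /=; rewrite in_fset_set// inE => /XA.
(* B controls the error of the difference quotient on X: steps s with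
   B s <= 1 lose at most 1, which was set aside in the choice of X. *)
pose B := \sum_(j <- X) b a j * (j c)%:R ^+ 2.
have B0 : 0 <= B.
  rewrite /B big_seq; apply: sumr_ge0 => j jX.
  by rewrite mulr_ge0 ?sqr_ge0// (rate_ge0 hb)//; exact: XA.
have B10 : 0 < B + 1 by rewrite ltr_wpDl.
exists (B + 1)^-1; first by rewrite /= invr_gt0.
move=> h /= hB hn0 /shift_cube /andP[h1 h0].
pose s := - h.
have s0 : 0 < s by rewrite oppr_gt0 lt_neqAle hn0.
have s01 : 0 < s <= 1 by rewrite s0 /s; lra.
have -> : h = - s by rewrite opprK.
apply: le_trans (difference_quotient_ge c s01 XA).
have sB : B * s <= 1.
  have : s <= (B + 1)^-1 by move: hB; rewrite sub0r normrN ler0_norm// => /ltW.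
  move=> /(ler_wpM2l B0) /le_trans; apply.
  by rewrite ler_pdivrMr// mul1r lerDl.
have -> : \sum_(j <- X) b a j * ((j c)%:R - (j c)%:R ^+ 2 * s) =
   \sum_(j <- X) b a j * (j c)%:R - B * s.
  by rewrite /B mulr_suml -sumrB; apply: eq_bigr => j _; ring.
by move: HX sB; lra.
Qed.

End Moments.

End Offspring.

(** * The Euler scheme in a closed set *)

Section Euler.
Variables (R : realType) (V : completeNormedModType R) (K : set V) (f : V -> V).
Variables (M L h0 : R) (x : V).
Hypotheses (Kclosed : closed K) (Kx : K x) (M0 : 0 <= M) (L0 : 0 <= L) (h00 : 0 < h0).
Hypothesis f_bound : forall u, K u -> `|f u| <= M.
Hypothesis f_lip : forall u v, K u -> K v -> `|f u - f v| <= L * `|u - v|.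
Hypothesis f_step : forall u h, K u -> 0 <= h <= h0 -> K (u + h *: f u).

Definition euler (h : R) (m : nat) : V := iter m (fun u => u + h *: f u) x.

Lemma euler_in h m : 0 <= h <= h0 -> K (euler h m).
Proof. by move=> h01; elim: m => [//|m IH]; exact: f_step. Qed.

Lemma euler_lip h m k : 0 <= h <= h0 -> `|euler h (m + k) - euler h m| <= k%:R * h * M.
Proof.
move=> h01; have /andP[h_ge0 _] := h01.
elim: k => [|k IH]; first by rewrite addn0 subrr normr0 !mul0r.
rewrite addnS {1}/euler /= -/(euler h (m + k)) addrAC.
rewrite (le_trans (ler_normD _ _))// -natr1 mulrDl mulrDl mul1r lerD//.
by rewrite normrZ ger0_norm// ler_wpM2l// f_bound//; exact: euler_in.
Qed.

(** This bound does not depend on the mesh except through the elapsed time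
[k h], so it survives in the limit and gives the derivative of the flow. *)
Lemma euler_tangent h m k : 0 <= h <= h0 ->
  `|euler h (m + k) - euler h m - (k%:R * h) *: f (euler h m)| <= L * M * (k%:R * h) ^+ 2.
Proof.
move=> h01; have /andP[h_ge0 _] := h01.
elim: k => [|k IH].
  by rewrite addn0 mul0r scale0r !subrr normr0 expr0n mulr0.
set u := euler h m in IH *; set v := euler h (m + k) in IH.
have -> : euler h (m + k.+1) - u - (k.+1%:R * h) *: f u =
   (v - u - (k%:R * h) *: f u) + h *: (f v - f u).
  rewrite addnS {1}/euler /= -/(euler h (m + k)) -/v -natr1 mulrDl mul1r.
  rewrite scalerDl scalerBr opprD.
  rewrite -!addrA; congr (_ + _); rewrite addrCA; congr (_ + _).
  by rewrite addrCA.
rewrite (le_trans (ler_normD _ _))//.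
have H1 : `|h *: (f v - f u)| <= h * (L * (k%:R * h * M)).
  rewrite normrZ ger0_norm// ler_wpM2l//.
  apply: (le_trans (f_lip (euler_in _ h01) (euler_in _ h01))).
  by rewrite ler_wpM2l// euler_lip.
apply: (le_trans (lerD IH H1)).
have LM0 : 0 <= L * M by rewrite mulr_ge0.
rewrite -natr1 -subr_ge0.
have -> : L * M * ((k%:R + 1) * h) ^+ 2 -
   (L * M * (k%:R * h) ^+ 2 + h * (L * (k%:R * h * M))) =
   L * M * h ^+ 2 * (k%:R + 1) by ring.
by rewrite !mulr_ge0 ?sqr_ge0// addr_ge0.
Qed.

(** Two half steps differ from one step by at most [L M h^2], and a step expands
distances by a factor at most [1 + L h]. *)
Lemma euler_halving h m : 0 <= h <= h0 ->
  `|euler (h / 2) m.*2 - euler h m| <= m%:R * h ^+ 2 * (L * M) * (1 + L * h) ^+ m.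
Proof.
move=> h01; have /andP[h_ge0 hh0] := h01.
have h201 : 0 <= h / 2 <= h0 by apply/andP; split; lra.
have C0 : 0 <= L * M by rewrite mulr_ge0.
have q1 : 1 <= 1 + L * h by rewrite lerDl mulr_ge0.
elim: m => [|m IH]; first by rewrite double0 subrr normr0 !mul0r.
set v := euler (h / 2) m.*2 in IH; set w := euler h m in IH.
have Kv : K v by exact: euler_in.
have Kw : K w by exact: euler_in.
pose v' := v + (h / 2) *: f v.
have Kv' : K v' by exact: f_step.
have -> : euler (h / 2) m.+1.*2 - euler h m.+1 =
   (v - w) + h *: (f v - f w) + (h / 2) *: (f v' - f v).
  rewrite doubleS /euler /= -/(euler (h / 2) m.*2) -/(euler h m) -/v -/w -/v' {1}/v'.
  rewrite !scalerBr.
  set a := (h / 2) *: f v; set c := (h / 2) *: f v'; set e := h *: f w.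
  have -> : h *: f v = a + a by rewrite -scalerDl; congr (_ *: _); lra.
  have -> : v + a + c = (v + a + a) + (c - a) by rewrite [RHS]addrACA subrr addr0.
  by rewrite -(addrA v) [LHS]addrAC opprD; congr (_ + _); rewrite addrACA.
have H1 : `|h *: (f v - f w)| <= h * (L * `|v - w|).
  by rewrite normrZ ger0_norm// ler_wpM2l// f_lip.
have H2 : `|(h / 2) *: (f v' - f v)| <= h ^+ 2 * (L * M).
  have h2_ge0 : 0 <= h / 2 by case/andP: h201.
  rewrite normrZ ger0_norm//.
  have H3 : `|f v' - f v| <= L * (h / 2 * M).
    apply: (le_trans (f_lip Kv' Kv)); rewrite ler_wpM2l// /v' addrC addKr.
    by rewrite normrZ ger0_norm// ler_wpM2l// f_bound.
  apply: (le_trans (ler_wpM2l h2_ge0 H3)).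
  have : 0 <= h ^+ 2 * (L * M) by rewrite mulr_ge0// sqr_ge0.
  by rewrite expr2; nra.
apply: (le_trans (ler_normD _ _)).
apply: (le_trans (lerD (ler_normD _ _) H2)).
apply: (@le_trans _ _ ((1 + L * h) * `|v - w| + h ^+ 2 * (L * M))).
  by rewrite lerD2r mulrDl mul1r lerD2l -mulrA mulrCA.
have q0 : 0 <= 1 + L * h by rewrite (le_trans ler01).
apply: (@le_trans _ _ (m%:R * h ^+ 2 * (L * M) * (1 + L * h) ^+ m.+1 + h ^+ 2 * (L * M))).
  by rewrite lerD2r [(1 + L * h) ^+ m.+1]exprS [leRHS]mulrCA ler_wpM2l.
have : h ^+ 2 * (L * M) * 1 <= h ^+ 2 * (L * M) * (1 + L * h) ^+ m.+1.
  by rewrite ler_wpM2l ?exprn_ege1// mulr_ge0// sqr_ge0.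
by rewrite -natr1; lra.
Qed.

Definition mesh (n : nat) : R := h0 / 2 ^+ n.

Definition polygon (n : nat) (t : R) : V := euler (mesh n) (Num.truncn (t / mesh n)).

Lemma mesh_gt0 n : 0 < mesh n.
Proof. by rewrite divr_gt0// exprn_gt0. Qed.

Lemma mesh_range n : 0 <= mesh n <= h0.
Proof.
by rewrite (ltW (mesh_gt0 n)) ler_pdivrMr ?exprn_gt0// ler_peMr ?(ltW h00)// exprn_ege1// ler1n.
Qed.

Lemma meshS n : mesh n.+1 = mesh n / 2.
Proof. by rewrite /mesh exprSr invfM mulrA. Qed.

Lemma mesh_cvg0 : mesh n @[n --> \oo] --> 0.
Proof.
have half1 : `|2^-1 : R| < 1 by rewrite ger0_norm ?invr_ge0// invf_lt1 ?ltr1n.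
rewrite (_ : mesh = geometric h0 2^-1); first exact: cvg_geometric.
by apply/funext => n; rewrite /= /mesh exprVn.
Qed.

Lemma truncn_mesh n t : 0 <= t ->
  (Num.truncn (t / mesh n))%:R * mesh n <= t < ((Num.truncn (t / mesh n))%:R + 1) * mesh n.
Proof.
move=> t0; have m0 := mesh_gt0 n.
have := truncn_itv (divr_ge0 t0 (ltW m0)).
by rewrite ler_pdivlMr// ltr_pdivrMr// natr1.
Qed.

Lemma polygon_in n t : K (polygon n t).
Proof. by apply: euler_in; exact: mesh_range. Qed.

(** The bound is geometric in [n], so the polygons converge.  The term [M] accounts
for the half step by which the two grids may disagree below [t]. *)
Lemma polygon_step n t : 0 <= t ->
  `|polygon n.+1 t - polygon n t| <= (M + t * (L * M) * expR (L * t)) * mesh n.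
Proof.
move=> t0; rewrite /polygon meshS.
have h01 := mesh_range n; have hp := mesh_gt0 n; have h0' := ltW hp.
have /andP[mt tm] := truncn_mesh n t0.
set h := mesh n in h01 hp h0' mt tm *.
set m := Num.truncn (t / h) in mt tm *.
set k := Num.truncn (t / (h / 2)).
have y0 : 0 <= t / (h / 2) by apply: divr_ge0 => //; apply: divr_ge0.
have yE : t / (h / 2) = 2 * (t / h) by field; rewrite gt_eqF.
have k1 : (m.*2 <= k)%N.
  rewrite truncn_ge_nat// yE -muln2 natrM mulrC ler_pM2l//.
  by rewrite ler_pdivlMr.
have k2 : (k < m.+1.*2)%N.
  rewrite truncn_lt_nat// yE -muln2 natrM mulrC ltr_pM2r//.
  by rewrite ltr_pdivrMr// -natr1.
have [r kE r1] : exists2 r, k = (m.*2 + r)%N & (r <= 1)%N.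
  exists (k - m.*2)%N; first by rewrite subnKC.
  by rewrite leq_subLR addn1 -ltnS -doubleS.
have h201 : 0 <= h / 2 <= h0 by case/andP: h01 => ? ?; apply/andP; split; lra.
rewrite kE -(subrK (euler (h / 2) m.*2) (euler (h / 2) (m.*2 + r))) -addrA.
apply: (le_trans (ler_normD _ _)).
apply: (le_trans (lerD (euler_lip _ _ h201) (euler_halving _ h01))).
rewrite [leRHS]mulrDl lerD//.
  rewrite [leRHS]mulrC ler_wpM2r//.
  apply: (@le_trans _ _ (1 * (h / 2))); last by rewrite mul1r ler_pdivrMr// ler_peMr// ler1n.
  by case/andP: h201 => h2_ge0 _; rewrite ler_wpM2r// lern1.
have C0 : 0 <= L * M by rewrite mulr_ge0.
have -> : m%:R * h ^+ 2 * (L * M) * (1 + L * h) ^+ m =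
  (m%:R * h) * (L * M) * (1 + L * h) ^+ m * h by ring.
rewrite ler_wpM2r// ler_pM ?exprn_ge0//.
- by apply: mulr_ge0 => //; apply: mulr_ge0.
- by apply: addr_ge0 => //; apply: mulr_ge0.
- by rewrite ler_wpM2r.
apply: (@le_trans _ _ (expR (L * h) ^+ m)).
  by apply: lerXn2r; rewrite ?nnegrE ?expR_ge0 ?expR_ge1Dx ?addr_ge0//; apply: mulr_ge0.
by rewrite -expRM_natl ler_expR mulrCA ler_wpM2l.
Qed.

Definition flow (t : R) : V := lim (polygon n t @[n --> \oo]).

Lemma polygon_cvg t : 0 <= t -> polygon n t @[n --> \oo] --> flow t.
Proof.
move=> t0; rewrite /flow.
pose A := M + t * (L * M) * expR (L * t).
have A0 : 0 <= A by rewrite addr_ge0// !mulr_ge0// expR_ge0.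
have half1 : `|2^-1 : R| < 1 by rewrite ger0_norm ?invr_ge0// invf_lt1 ?ltr1n.
have cs : cvgn (series (telescope (polygon ^~ t))).
  apply: normed_cvg; apply: series_le_cvg (is_cvg_geometric_series (a := A * h0) half1).
  - by move=> n /=.
  - by move=> n; rewrite /= mulr_ge0 ?exprn_ge0 ?invr_ge0// mulr_ge0// ltW.
  - move=> n /=; apply: (le_trans (polygon_step n t0)).
    by rewrite /mesh -/A mulrA exprVn.
rewrite telescopeK in cs.
have : cvgn ((fun n => polygon n t - polygon 0 t) \+ cst (polygon 0 t)).
  by apply: is_cvgD => //; exact: is_cvg_cst.
by congr (cvgn _); apply/funext => n /=; rewrite subrK.
Qed.

Lemma flow_in t : 0 <= t -> K (flow t).
Proof.
move=> t0; apply: (closed_cvg _ Kclosed) (polygon_cvg t0).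
by apply: nearW => n; exact: polygon_in.
Qed.

Lemma flow0 : flow 0 = x.
Proof.
have : polygon n 0 @[n --> \oo] --> x.
  by rewrite (_ : (fun n => _) = cst x); [exact: cvg_cst|
    apply/funext => n; rewrite /polygon mul0r truncn0].
exact: cvg_lim.
Qed.

Lemma flow_tangent t s : 0 <= t -> 0 <= s ->
  `|flow (t + s) - flow t - s *: f (flow t)| <= L * M * s ^+ 2.
Proof.
move=> t0 s0; have ts0 : 0 <= t + s by rewrite addr_ge0.
pose k n := (Num.truncn ((t + s) / mesh n) - Num.truncn (t / mesh n))%N.
have kE n : Num.truncn ((t + s) / mesh n) = (Num.truncn (t / mesh n) + k n)%N.
  rewrite /k subnKC// le_truncn// ler_wpM2r ?lerDl// invr_ge0 ltW//.
  exact: mesh_gt0.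
have kh : (k n)%:R * mesh n @[n --> \oo] --> s.
  have kb n : s - mesh n <= (k n)%:R * mesh n <= s + mesh n.
    have /andP[a1 a2] := truncn_mesh n t0.
    have /andP[a3 a4] := truncn_mesh n ts0.
    move: a1 a2 a3 a4; rewrite kE natrD.
    move: (mesh n) (Num.truncn _) (k n) => h i j ? ? ? ?.
    by apply/andP; split; lra.
  apply: (@squeeze_cvgr _ _ _ _ (fun n => s - mesh n) (fun n => s + mesh n)).
  - by apply: nearW.
  - by rewrite -[X in _ --> X]subr0; apply: cvgB; [exact: cvg_cst|exact: mesh_cvg0].
  - by rewrite -[X in _ --> X]addr0; apply: cvgD; [exact: cvg_cst|exact: mesh_cvg0].
have fc : f (polygon n t) @[n --> \oo] --> f (flow t).
  apply/cvgrPdist_le => e e0.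
  have L10 : 0 < L + 1 by rewrite ltr_wpDl.
  have /cvgrPdist_le /(_ _ (divr_gt0 e0 L10)) := polygon_cvg t0.
  apply: filterS => n Hn.
  apply: (le_trans (f_lip (flow_in t0) (polygon_in n t))).
  apply: (le_trans (ler_wpM2l L0 Hn)).
  by rewrite mulrCA ler_piMr ?(ltW e0)// ler_pdivrMr// mul1r lerDl.
have c1 : `|polygon n (t + s) - polygon n t - ((k n)%:R * mesh n) *: f (polygon n t)|
    @[n --> \oo] --> `|flow (t + s) - flow t - s *: f (flow t)|.
  apply: cvg_norm; apply: cvgB; last exact: cvgZ.
  by apply: cvgB; exact: polygon_cvg.
have c2 : L * M * ((k n)%:R * mesh n) ^+ 2 @[n --> \oo] --> L * M * s ^+ 2.
  by apply: cvgM; [exact: cvg_cst|rewrite !expr2; exact: cvgM].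
apply: ler_cvg_to c1 c2 _; apply: nearW => n.
by rewrite /polygon kE; apply: euler_tangent; exact: mesh_range.
Qed.

Lemma flow_lip t s : 0 <= t -> 0 <= s -> `|flow (t + s) - flow t| <= M * s + L * M * s ^+ 2.
Proof.
move=> t0 s0; rewrite -(subrK (s *: f (flow t)) (flow (t + s) - flow t)).
rewrite addrC (le_trans (ler_normD _ _))// lerD ?flow_tangent//.
by rewrite normrZ ger0_norm// mulrC ler_wpM2r// f_bound//; exact: flow_in.
Qed.

(** For negative [s] the tangent estimate is applied at [t + s], and the change of
the slope between [t + s] and [t] is of order [s]. *)
Lemma flow_derivative t e : 0 <= t -> 0 < e -> exists2 d, 0 < d & forall s, 0 <= t + s ->
  `|s| < d -> `|flow (t + s) - flow t - s *: f (flow t)| <= e * `|s|.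
Proof.
move=> t0 e0.
pose C := L * M * (2 + L).
have LM0 : 0 <= L * M by rewrite mulr_ge0.
have C0 : 0 <= C by rewrite mulr_ge0// addr_ge0.
have C10 : 0 < C + 1 by rewrite ltr_wpDl.
exists (Num.min 1 (e / (C + 1))); first by rewrite lt_min ltr01 divr_gt0.
move=> s ts0; rewrite lt_min => /andP[s1 se].
suff : `|flow (t + s) - flow t - s *: f (flow t)| <= C * `|s| ^+ 2.
  move=> /le_trans; apply; rewrite expr2 mulrA ler_wpM2r//.
  have : C * `|s| <= C * (e / (C + 1)) by rewrite ler_wpM2l// ltW.
  move=> /le_trans; apply.
  by rewrite mulrCA ler_piMr ?(ltW e0)// ler_pdivrMr// mul1r lerDl.
have [s0|s0] := leP 0 s.
  apply: (le_trans (flow_tangent t0 s0)); rewrite ger0_norm// ler_wpM2r ?sqr_ge0//.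
  by rewrite /C ler_peMr//; have := L0; lra.
pose r := - s; have r0 : 0 <= r by rewrite oppr_ge0 ltW.
pose t' := t + s.
have tE : t = t' + r by rewrite /t' /r addrK.
have sE : s = - r by rewrite opprK.
have r1 : r < 1 by rewrite /r -(ltr0_norm s0).
rewrite -/t' (ltr0_norm s0) -/r.
have -> : flow t' - flow t - s *: f (flow t) =
   - (flow t - flow t' - r *: f (flow t')) + r *: (f (flow t) - f (flow t')).
  rewrite sE scaleNr opprK scalerBr !opprB.
  by rewrite [RHS]addrC [RHS]addrA subrK [RHS]addrC.
have Kt : K (flow t) by exact: flow_in.
have Kt' : K (flow t') by exact: flow_in.
apply: (le_trans (ler_normD _ _)); rewrite normrN {1}tE.
apply: (le_trans (lerD (flow_tangent ts0 r0) (lexx _))).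
rewrite normrZ ger0_norm//.
have H1 : `|f (flow t) - f (flow t')| <= L * (M * r + L * M * r ^+ 2).
  by apply: (le_trans (f_lip Kt Kt')); rewrite ler_wpM2l// {1}tE flow_lip.
have := ler_wpM2l r0 H1.
have : 0 <= L * (L * M) * r ^+ 2 * (1 - r) by rewrite !mulr_ge0 ?sqr_ge0 ?subr_ge0// ltW.
rewrite /C; move: (r * `|_|) => N; nra.
Qed.

End Euler.

(** * The differential equation on the unit square *)

(** Joins the completeness of spaces of matrices to their norm. *)
HB.instance Definition _ (R : realType) m n := Complete.on 'M[R]_(m, n).

Lemma row_norm_le (R : realType) n (u : 'rV[R]_n) (c : R) : 0 <= c ->
  (forall a, `|u 0 a| <= c) -> `|u| <= c.
Proof.
move=> c0 uc; rewrite -[leLHS]/(mx_norm u) mx_normrE; apply/bigmax_leP; split=> //.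
by move=> [i a] _ /=; rewrite (ord1 i).
Qed.

Lemma row_coord_le (R : realType) n (u : 'rV[R]_n) a : `|u 0 a| <= `|u|.
Proof. rewrite -[leRHS]/(mx_norm u) mx_normrE; apply: (le_bigmax _ _ (0, a)). Qed.

Lemma monom_I2 (R : realType) (x : 'I_2 -> R) j : monom x j = x 0 ^+ j 0 * x 1 ^+ j 1.
Proof.
rewrite /monom big_ord_recl big_ord1.
by rewrite (_ : lift ord0 0 = 1)//; exact/val_inj.
Qed.

(** Both sides are used: the limit for the product rule, the estimate to pass to
and from the flow and the backward equation. *)
Lemma has_derivativeP (R : realType) (g : R -> R) (t l : R) :
  has_derivative_within [set s | 0 <= s] g t l <->
  forall e, 0 < e -> exists2 d, 0 < d & forall h, 0 <= t + h -> `|h| < d ->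
    `|g (t + h) - g t - h * l| <= e * `|h|.
Proof.
rewrite /has_derivative_within; split.
  move=> /cvgrPdist_le H e e0; have [d /= d0 Hd] := H e e0.
  exists d => // h th hd; have [->|hn0] := eqVneq h 0.
    by rewrite addr0 subrr mul0r subrr normr0 mulr0.
  have := Hd h; rewrite /= sub0r normrN => /(_ hd hn0 th) H1.
  have -> : g (t + h) - g t - h * l = - h * (l - (g (t + h) - g t) / h) by field.
  by rewrite normrM normrN mulrC ler_wpM2r.
move=> H; apply/cvgrPdist_le => e e0; have [d d0 Hd] := H e e0.
exists d => // h /=; rewrite sub0r normrN => hd hn0 th.
have := Hd h th hd.
have -> : g (t + h) - g t - h * l = - h * (l - (g (t + h) - g t) / h) by field.
by rewrite normrM normrN mulrC ler_pM2r// normr_gt0.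
Qed.

Section DerivativeWithin.
Variables (R : realType) (D : set R).
Implicit Types (f g : R -> R).

Lemma derivative_within_cont f t l : has_derivative_within D f t l ->
  f (t + h) @[h --> within [set h | D (t + h)] 0^'] --> f t.
Proof.
move=> df; set F := within _ _ in df *.
have h0 : h @[h --> F] --> (0 : R).
  by do 2 (apply: cvg_within_filter); exact: cvg_id.
have : f t + h * ((f (t + h) - f t) / h) @[h --> F] --> f t + 0 * l.
  by apply: cvgD; [exact: cvg_cst|exact: cvgM].
rewrite mul0r addr0; apply: cvg_trans; apply: near_eq_cvg.
apply: filterS (_ : F [set h | h != 0]).
  by move=> h /= h0'; rewrite mulrCA divff// mulr1 addrC subrK.
have nz : (0 : R)^' [set h | h != 0] by exact: withinT.
by rewrite /F /within /=; apply: filterS nz => h.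
Qed.

Lemma derivative_within_cst c t : has_derivative_within D (fun=> c) t 0.
Proof.
rewrite /has_derivative_within.
under eq_fun do rewrite subrr mul0r.
exact: cvg_cst.
Qed.

Lemma derivative_withinM f g t l m :
  has_derivative_within D f t l -> has_derivative_within D g t m ->
  has_derivative_within D (fun s => f s * g s) t (l * g t + f t * m).
Proof.
move=> df dg; have cg := derivative_within_cont dg.
rewrite /has_derivative_within.
under eq_fun => h.
  rewrite (_ : _ / h = (f (t + h) - f t) / h * g (t + h) +
                       f t * ((g (t + h) - g t) / h)); last by ring.
  over.
by apply: cvgD; [exact: cvgM|apply: cvgM => //; exact: cvg_cst].
Qed.

Lemma derivative_withinX f t l n : has_derivative_within D f t l ->
  has_derivative_within D (fun s => f s ^+ n) t (n%:R * f t ^+ n.-1 * l).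
Proof.
move=> df; elim: n => [|n IH].
  by under eq_fun do rewrite expr0; rewrite !mul0r; exact: derivative_within_cst.
under eq_fun do rewrite exprS.
have -> : n.+1%:R * f t ^+ n.+1.-1 * l = l * f t ^+ n + f t * (n%:R * f t ^+ n.-1 * l).
  rewrite -natr1 /=; case: n {IH} => [|n /=]; first by rewrite expr0; ring.
  by rewrite exprS; ring.
exact (derivative_withinM df IH).
Qed.

End DerivativeWithin.

Section CubeField.
Variables (R : realType) (b : 'I_2 -> vec -> R) (w : 'I_2 -> vec -> R).
Hypotheses (hb : offspring_rates b) (hA2 : assumption_A2 b).
Hypothesis w01 : forall a j, 0 <= w a j <= 1.

(** First moment of the offspring rates of type [a].  Added to the total split rate
[- b a (unitv a)] it is a Lipschitz constant of [vfield b w a]; it also bounds the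
drift of the population size. *)
Definition moment (a : 'I_2) : R := offspring_sum b a (fun j => (j 0)%:R + (j 1)%:R).

Lemma moment_sum_summable a :
  rsummable [set j | j != unitv a] (fun j => b a j * ((j 0)%:R + (j 1)%:R)).
Proof.
apply: (@eq_rsummable _ _ _ (fun j => b a j * (j 0)%:R + b a j * (j 1)%:R)).
  by move=> j _; rewrite mulrDr.
by apply: rsummableD; try exact: moment_summable;
  move=> j ju; rewrite mulr_ge0// (rate_ge0 hb).
Qed.

Lemma moment_ge0 a : 0 <= moment a.
Proof. by apply: rsum_ge0 => j ju; rewrite mulr_ge0 ?(rate_ge0 hb)// addr_ge0. Qed.

Lemma expr_le_lip n (x y d : R) : 0 <= x <= 1 -> 0 <= y <= 1 -> x <= y + d -> 0 <= d ->
  x ^+ n <= y ^+ n + n%:R * d.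
Proof.
move=> /andP[x0 x1] /andP[y0 y1] xyd d0; elim: n => [|n IH]; first by rewrite !expr0 mul0r addr0.
rewrite !exprS.
have yn0 : 0 <= y ^+ n by rewrite exprn_ge0.
have yn1 : y ^+ n <= 1 by rewrite exprn_ile1.
have nd0 : 0 <= n%:R * d by rewrite mulr_ge0.
have H1 := ler_wpM2l x0 IH.
have H2 : x * (n%:R * d) <= n%:R * d by rewrite ler_piMl.
have H3 := ler_wpM2r yn0 xyd.
have H4 : d * y ^+ n <= d by rewrite ler_piMr.
rewrite -natr1; move: H1 H2 H3 H4; move: (y ^+ n) (x ^+ n) => p q; lra.
Qed.

Lemma monom_le_lip (x y : 'I_2 -> R) j d : in_cube x -> in_cube y ->
  (forall a, x a <= y a + d) -> 0 <= d ->
  monom x j <= monom y j + ((j 0)%:R + (j 1)%:R) * d.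
Proof.
move=> x01 y01 xyd d0; rewrite !monom_I2.
have H a := expr_le_lip (j a) (x01 a) (y01 a) (xyd a) d0.
have p1 (z : 'I_2 -> R) a : in_cube z -> 0 <= z a ^+ j a <= 1.
  by move=> /(_ a) /andP[? ?]; rewrite exprn_ge0// exprn_ile1.
have nd a : 0 <= (j a)%:R * d by rewrite mulr_ge0.
move: (H 0) (H 1) (p1 x 0 x01) (p1 x 1 x01) (p1 y 0 y01) (p1 y 1 y01) (nd 0) (nd 1).
move: (x 0 ^+ _) (x 1 ^+ _) (y 0 ^+ _) (y 1 ^+ _) => X0 X1 Y0 Y1.
rewrite mulrDl; move: (_ * d) (_ * d) => m0 m1 h0 h1.
move=> /andP[? ?] /andP[? ?] /andP[? ?] /andP[? ?] ? ?.
nra.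
Qed.

Lemma monom_weight_le1 a (x : 'I_2 -> R) (j : vec) : in_cube x -> 0 <= monom x j * w a j <= 1.
Proof.
move=> x01; have /andP[w0 w1] := w01 a j.
by rewrite mulr_ge0 ?monom_ge0// mulr_ile1 ?monom_ge0 ?monom_le1.
Qed.

Lemma offspring_sum_range a F : (forall j, 0 <= F j <= 1) ->
  0 <= offspring_sum b a F <= - b a (unitv a).
Proof.
move=> F01; rewrite -offspring_total//; apply/andP; split.
  by apply: rsum_ge0 => j ju; rewrite mulr_ge0 ?(rate_ge0 hb)//; case/andP: (F01 j).
apply: rsum_le; last exact: offspring_summable.
move=> j ju; case/andP: (F01 j) => F0 F1.
by rewrite mulr_ge0 ?(rate_ge0 hb)//= ler_piMr ?(rate_ge0 hb).
Qed.

Lemma vfield_le_lip a (x y : 'I_2 -> R) d : in_cube x -> in_cube y ->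
  (forall c, x c <= y c + d) -> (forall c, y c <= x c + d) -> 0 <= d ->
  vfield b w a x <= vfield b w a y + (moment a - b a (unitv a)) * d.
Proof.
move=> x01 y01 xyd yxd d0; rewrite /vfield.
have bu := rate_unit_le0 hb a.
have H1 : b a (unitv a) * x a <= b a (unitv a) * y a - b a (unitv a) * d.
  by rewrite -mulrBr ler_wnM2l//; have := yxd a; lra.
suff : offspring_sum b a (fun j => monom x j * w a j) <=
       offspring_sum b a (fun j => monom y j * w a j) + moment a * d.
  by move: H1; move: (offspring_sum _ _ _) (offspring_sum _ _ _) => p q; lra.
rewrite [_ * d]mulrC /moment /offspring_sum.
rewrite -rsumZ//; last exact: moment_sum_summable; last first.
  by move=> j ju; rewrite mulr_ge0 ?(rate_ge0 hb)// addr_ge0.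
have yw j := monom_weight_le1 a j y01.
have xw j := monom_weight_le1 a j x01.
have m0 j : 0 <= (j 0)%:R + (j 1)%:R :> R by rewrite addr_ge0.
have sy : rsummable [set j | j != unitv a] (fun j => b a j * (monom y j * w a j)).
  by apply: offspring_summable_le1 => // j; case/andP: (yw j).
have sd : rsummable [set j | j != unitv a] (fun j : vec => d * (b a j * ((j 0)%:R + (j 1)%:R))).
  apply: rsummableZ => //; last exact: moment_sum_summable.
  by move=> j ju; rewrite mulr_ge0 ?(rate_ge0 hb).
have y0 j : j != unitv a -> 0 <= b a j * (monom y j * w a j).
  by move=> ju; rewrite mulr_ge0 ?(rate_ge0 hb)//; case/andP: (yw j).
have dm0 j : j != unitv a -> 0 <= d * (b a j * ((j 0)%:R + (j 1)%:R)).
  by move=> ju; rewrite mulr_ge0// mulr_ge0 ?(rate_ge0 hb).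
rewrite -rsumD//; apply: rsum_le; last exact: rsummableD.
move=> j ju; apply/andP; split.
  by rewrite mulr_ge0 ?(rate_ge0 hb)//; case/andP: (xw j).
rewrite [d * _]mulrCA -mulrDr ler_wpM2l ?(rate_ge0 hb)//.
have /andP[w0 w1] := w01 a j.
apply: (le_trans (ler_wpM2r w0 (monom_le_lip j x01 y01 xyd d0))).
rewrite mulrDl lerD2l [d * _]mulrC ler_piMr//.
by rewrite mulr_ge0.
Qed.

Lemma vfield_bound a (x : 'I_2 -> R) : in_cube x -> `|vfield b w a x| <= - b a (unitv a).
Proof.
move=> x01; rewrite /vfield.
have /andP[H0 H1] := offspring_sum_range a (fun j => monom_weight_le1 a j x01).
have bu := rate_unit_le0 hb a; have /andP[x0 x1] := x01 a.
have : 0 <= - b a (unitv a) * x a by rewrite mulr_ge0// oppr_ge0.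
have : 0 <= - b a (unitv a) * (1 - x a) by rewrite mulr_ge0 ?oppr_ge0// subr_ge0.
move: H0 H1; move: (offspring_sum _ _ _) => p.
by rewrite ler_norml => ? ? ? ?; apply/andP; split; lra.
Qed.

(** The total rate of splits bounds the gain at a coordinate by the same rate
[- b a (unitv a)] that damps it, so a step moves the coordinate towards a point
of [0, 1]. *)
Lemma vfield_step a (x : 'I_2 -> R) h : in_cube x -> 0 <= h -> h * - b a (unitv a) <= 1 ->
  0 <= x a + h * vfield b w a x <= 1.
Proof.
move=> x01 h0 hb1; rewrite /vfield.
have /andP[H0 H1] := offspring_sum_range a (fun j => monom_weight_le1 a j x01).
have /andP[x0 x1] := x01 a.
have := ler_wpM2l h0 H0; have := ler_wpM2l h0 H1.
have : 0 <= (1 - h * - b a (unitv a)) * x a by rewrite mulr_ge0// subr_ge0.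
have : 0 <= (1 - h * - b a (unitv a)) * (1 - x a) by rewrite mulr_ge0 ?subr_ge0.
move: (offspring_sum _ _ _) => p ? ? ? ?.
by apply/andP; split; lra.
Qed.

Definition cube : set 'rV[R]_2 := [set u | in_cube (u 0)].

Lemma cube_closed : closed cube.
Proof.
have -> : cube = \bigcap_(a in [set: 'I_2]) ((fun u : 'rV[R]_2 => u 0 a) @^-1` `[0, 1]).
  apply/seteqP; split => [u u01 a _|u u01 a] /=; first by rewrite in_itv /= u01.
  by have := u01 a I; rewrite /= in_itv.
apply: closed_bigI => a _; apply: closed_comp.
  by move=> u _; exact: coord_continuous.
exact: itv_closed.
Qed.

Theorem ode_exists (x : 'rV[R]_2) : cube x ->
  exists u : R -> 'rV[R]_2, [/\ forall t, 0 <= t -> cube (u t), u 0 = x &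
    forall t a, 0 <= t ->
      has_derivative_within [set s | 0 <= s] (fun s => u s 0 a) t (vfield b w a (u t 0))].
Proof.
move=> Kx.
pose f (u : 'rV[R]_2) : 'rV[R]_2 := \row_a vfield b w a (u 0).
pose B : R := \sum_a - b a (unitv a).
pose L : R := \sum_a (moment a - b a (unitv a)).
have b0 a : 0 <= - b a (unitv a) by rewrite oppr_ge0 rate_unit_le0.
have B0 : 0 <= B by apply: sumr_ge0.
have Lt0 a : 0 <= moment a - b a (unitv a) by rewrite addr_ge0 ?moment_ge0.
have L0 : 0 <= L by apply: sumr_ge0.
have bB a : - b a (unitv a) <= B by rewrite /B (bigD1 a)//= lerDl sumr_ge0.
have lL a : moment a - b a (unitv a) <= L by rewrite /L (bigD1 a)//= lerDl sumr_ge0.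
have B10 : 0 < 1 + B by rewrite ltr_wpDr.
(* Steps up to h0 keep the square invariant since h0 B <= 1. *)
pose h0 : R := (1 + B)^-1.
have h00 : 0 < h0 by rewrite invr_gt0.
have f_bound u : cube u -> `|f u| <= B.
  by move=> Ku; apply: row_norm_le => // a; rewrite mxE (le_trans (vfield_bound a Ku)).
have f_lip u v : cube u -> cube v -> `|f u - f v| <= L * `|u - v|.
  move=> Ku Kv; apply: row_norm_le; first by rewrite mulr_ge0.
  move=> a; rewrite !mxE.
  have uv c : u 0 c <= v 0 c + `|u - v|.
    have := row_coord_le (u - v) c; rewrite !mxE ler_norml => /andP[_]; lra.
  have vu c : v 0 c <= u 0 c + `|u - v|.
    have := row_coord_le (u - v) c; rewrite !mxE ler_norml => /andP[+ _]; lra.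
  have := vfield_le_lip a Ku Kv uv vu (normr_ge0 _).
  have := vfield_le_lip a Kv Ku vu uv (normr_ge0 _).
  have : (moment a - b a (unitv a)) * `|u - v| <= L * `|u - v| by rewrite ler_wpM2r.
  by move=> ? ? ?; rewrite ler_norml; apply/andP; split; lra.
have f_step u h : cube u -> 0 <= h <= h0 -> cube (u + h *: f u).
  move=> Ku /andP[hp hh] a; rewrite !mxE; apply: vfield_step => //.
  apply: (@le_trans _ _ (h0 * B)); first by rewrite ler_pM.
  by rewrite /h0 mulrC ler_pdivrMr// mul1r lerDr.
exists (flow f h0 x); split.
- by move=> t t0; exact: (flow_in cube_closed Kx B0 L0 h00 f_bound f_lip f_step).
- exact: flow0.
move=> t a t0; apply/has_derivativeP => e e0.
have [d d0 Hd] := flow_derivative cube_closed Kx B0 L0 h00 f_bound f_lip f_step t0 e0.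
exists d => // h th hd; apply: le_trans (Hd h th hd).
set u1 := flow _ _ _ (t + h); set u2 := flow _ _ _ t.
by have := row_coord_le (u1 - u2 - h *: f u2) a; rewrite !mxE.
Qed.

End CubeField.

(** * Generating functions solving the backward equation *)

Lemma monom_add (R : realType) (I : finType) (x : I -> R) (i j : I -> nat) :
  monom x (fun a => (i a + j a)%N) = monom x i * monom x j.
Proof. by rewrite /monom -big_split; apply: eq_bigr => a _; rewrite /= exprD. Qed.

Lemma monom0 (R : realType) (I : finType) (x : I -> R) : monom x (fun=> 0%N) = 1.
Proof. by rewrite /monom big1// => a _; rewrite expr0. Qed.

Lemma eq_monom (R : realType) (I : finType) (x : I -> R) (i j : I -> nat) :
  i =1 j -> monom x i = monom x j.
Proof. by move=> ij; apply: eq_bigr => a _; rewrite ij. Qed.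

Lemma monom_mark (R : realType) (A : {fset vec}) (v : {ffun A -> R}) l j :
  monom v (addc l (mark A (zvec j))) = monom v l * weight v j.
Proof.
rewrite (@eq_monom _ _ _ _ (fun m => (l m + mark A (zvec j) m)%N)); last by move=> m; rewrite ffunE.
rewrite monom_add; congr (_ * _); rewrite /weight.
case: insubP => [m _ mj|jA].
  rewrite /monom (bigD1 m)//= ffunE mj eqxx expr1 big1 ?mulr1// => m' m'm.
  rewrite ffunE; case: eqP => // /zvec_inj e; case/eqP: m'm.
  by apply: val_inj; rewrite mj.
rewrite /monom big1// => m _; rewrite ffunE; case: eqP => // /zvec_inj e.
by move: jA; rewrite -e fsvalP.
Qed.

Definition weights (R : realType) (R1 R2 : {fset vec}) (y : {ffun R1 -> R})
    (z : {ffun R2 -> R}) (a : 'I_2) : vec -> R :=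
  if a == 0 then weight y else weight z.

Section BranchingSolutions.
Variables (R : realType) (b : 'I_2 -> vec -> R) (R1 R2 : {fset vec}).
Notation state := (bstate R1 R2).
Hypotheses (hb : offspring_rates b) (hA2 : assumption_A2 b).
Hypotheses (hR1 : unitv 0 \notin R1) (hR2 : unitv 1 \notin R2).
Variables (y : {ffun R1 -> R}) (z : {ffun R2 -> R}).
Hypotheses (y01 : in_cube y) (z01 : in_cube z).
Let w := weights y z.

Lemma weights_range a j : 0 <= w a j <= 1.
Proof. by rewrite /w /weights; case: eqP => _; exact: weight_range. Qed.

Lemma ode_solutionP (x : 'rV[R]_2) (u : R -> 'rV[R]_2) : ode_solution b x y z u <->
  [/\ forall t, 0 <= t -> in_cube (u t 0), u 0 = x &
    forall t a, 0 <= t ->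
      has_derivative_within [set s | 0 <= s] (fun s => u s 0 a) t (vfield b w a (u t 0))].
Proof.
have E0 t : in_cube (u t 0) -> markedB b 0 (u t) y + unmarkedB b 0 R1 (u t) = vfield b w 0 (u t 0).
  by move=> u01; rewrite marked_unmarked.
have E1 t : in_cube (u t 0) -> markedB b 1 (u t) z + unmarkedB b 1 R2 (u t) = vfield b w 1 (u t 0).
  by move=> u01; rewrite marked_unmarked.
split=> [[u01 ux e0 e1]|[u01 ux H]]; split=> //.
- move=> t a t0; have := e0 t t0; have := e1 t t0; rewrite E0 ?E1; try exact: u01.
  by move=> H1 H0; move: a; exact: I2_ind.
- by move=> t t0; rewrite E0; [exact: H|exact: u01].
- by move=> t t0; rewrite E1; [exact: H|exact: u01].
Qed.

(** The generating function of the counts for a population of independent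
individuals: each individual of type [a] contributes a factor [x a]. *)
Definition state_pgf (x : 'I_2 -> R) (s : state) : R :=
  monom y s.1.2 * monom z s.2 * monom x s.1.1.

Lemma state_pgf_range (x : 'I_2 -> R) s : in_cube x -> 0 <= state_pgf x s <= 1.
Proof.
move=> x01.
by rewrite !mulr_ge0 ?monom_ge0//= !mulr_ile1 ?mulr_ge0 ?monom_ge0 ?monom_le1.
Qed.

Definition marks (s : state) : R := monom y s.1.2 * monom z s.2.

Lemma marks_split a (s : state) (j : vec) :
  marks (split_state a s j) = marks s * w a j.
Proof.
rewrite /marks /split_state /= /count1 /count2 /w /weights.
have [->|a0] := eqVneq a 0; first by rewrite monom_mark mulrAC.
have [_|] := eqVneq a 1; first by rewrite monom_mark mulrA.
by move: a a0; apply: I2_ind; rewrite eqxx.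
Qed.

(** The derivative of [monom x i] in [x a] is [i a] times this monomial. *)
Definition monom_pred (x : 'I_2 -> R) (a : 'I_2) (i : vec) : R :=
  monom x (fun c => (i c - (c == a))%N).

Lemma monom_predK x a (i : vec) : (0 < i a)%N -> monom x i = monom_pred x a i * x a.
Proof.
move=> ia; rewrite /monom_pred -(monom_unitv x a) -monom_add; apply: eq_monom => c.
by rewrite ffunE; case: eqP => [->|_] /=; [rewrite addn1 subn1 prednK|rewrite subn0 addn0].
Qed.

(** A split replaces one factor [x a] by [monom x j * w a j]. *)
Lemma state_pgf_split x a (s : state) (j : vec) :
  state_pgf x (split_state a s j) = marks s * monom_pred x a s.1.1 * (monom x j * w a j).
Proof.
rewrite /state_pgf -/(marks (split_state a s j)) marks_split.
rewrite (@eq_monom _ _ _ _ (fun c => (s.1.1 c - (c == a) + j c)%N)); last first.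
  by move=> c; rewrite ffunE.
by rewrite monom_add -/(monom_pred x a s.1.1); ring.
Qed.

Lemma marks_ge0 s : 0 <= marks s.
Proof. by rewrite mulr_ge0 ?monom_ge0. Qed.

Lemma monom_pred_ge0 x a i : in_cube x -> 0 <= monom_pred x a i.
Proof. exact: monom_ge0. Qed.

(** The generator acts on [state_pgf x] as the derivation along [vfield b w]. *)
Lemma generator_state_pgf x (s : state) : in_cube x ->
  generator (@birth_Q R b R1 R2) (state_pgf x) s =
  marks s * \sum_a (s.1.1 a)%:R * monom_pred x a s.1.1 * vfield b w a x.
Proof.
move=> x01; rewrite /generator.
have p01 s' := state_pgf_range s' x01.
have p0 s' : 0 <= state_pgf x s' by case/andP: (p01 s').
have p1 s' : state_pgf x s' <= 1 by case/andP: (p01 s').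
have mw a j := monom_weight_le1 weights_range a j x01.
have sp a : rsummable [set j | j != unitv a] (fun j => b a j * state_pgf x (split_state a s j)).
  exact: offspring_summable_le1.
have [_ ->] := jump_birth hb hR1 hR2 p0 sp.
rewrite birth_QE// mulr_suml mulr_sumr -big_split; apply: eq_bigr => a _ /=.
rewrite split_rate_diag//.
have -> : rsum [set j | j != unitv a] (fun j => b a j * state_pgf x (split_state a s j)) =
   marks s * monom_pred x a s.1.1 * offspring_sum b a (fun j => monom x j * w a j).
  rewrite /offspring_sum -rsumZ.
  - by apply: eq_rsum => j _; rewrite state_pgf_split; ring.
  - by rewrite mulr_ge0 ?marks_ge0 ?monom_pred_ge0.
  - by move=> j ju; rewrite mulr_ge0 ?(rate_ge0 hb)//; case/andP: (mw a j).
  - by apply: offspring_summable_le1 => // j; case/andP: (mw a j).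
have [->|sa] := posnP (s.1.1 a); first by rewrite !mul0r mulr0 addr0.
by rewrite /state_pgf (monom_predK x sa) /vfield -/(marks s); ring.
Qed.

Lemma ode_backward (x : 'rV[R]_2) (u : R -> 'rV[R]_2) : ode_solution b x y z u ->
  backward_solution (@birth_Q R b R1 R2) (fun t => state_pgf (u t 0)).
Proof.
move=> /ode_solutionP[u01 ux du].
have dU t s : 0 <= t ->
    has_derivative_within [set r | 0 <= r] (fun r => state_pgf (u r 0) s) t
      (generator (@birth_Q R b R1 R2) (state_pgf (u t 0)) s).
  move=> t0; rewrite generator_state_pgf; last exact: u01.
  rewrite (_ : (fun r => state_pgf (u r 0) s) =
     (fun r => marks s * (u r 0 0 ^+ s.1.1 0 * u r 0 1 ^+ s.1.1 1))); last first.
    by apply/funext => r; rewrite /state_pgf monom_I2.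
  have d0 := @derivative_withinX _ _ _ _ _ (s.1.1 0) (du t 0 t0).
  have d1 := @derivative_withinX _ _ _ _ _ (s.1.1 1) (du t 1 t0).
  have dM := derivative_withinM (derivative_within_cst _ (marks s) t) (derivative_withinM d0 d1).
  rewrite sum_I2 /monom_pred !monom_I2 /= !subn1 !subn0.
  move: dM; rewrite mul0r add0r.
  move: (vfield b w 0 _) (vfield b w 1 _) => f0 f1.
  set l := (X in has_derivative_within _ _ _ X).
  set l' := (X in _ -> has_derivative_within _ _ _ X).
  suff -> : l = l' by [].
  rewrite /l /l' {l l' du}. 
  move: (marks s) (u t 0 0 ^+ _) (u t 0 1 ^+ _) (u t 0 0 ^+ _) (u t 0 1 ^+ _).
  move: ((s.1.1 0)%:R : R) ((s.1.1 1)%:R : R) => n0 n1 c p1 q1 p0 q0.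
  by ring.
split.
- by move=> t s t0; apply: state_pgf_range; exact: u01.
- move=> s t e t0 e0.
  have /has_derivativeP /(_ _ ltr01)[d d0 Hd] := dU t s t0.
  set l := generator _ _ _ in Hd.
  have l1 : 0 < 1 + `|l| by rewrite ltr_pwDl.
  exists (Num.min d (e / (1 + `|l|))); first by rewrite lt_min d0 divr_gt0.
  move=> r r0; rewrite lt_min => /andP[rd re].
  have := Hd (r - t); rewrite (addrC t) subrK => /(_ r0 rd) H1.
  rewrite -(subrK ((r - t) * l) (_ - _)) (le_trans (ler_normD _ _))//.
  apply: (le_trans (lerD H1 (lexx _))); rewrite normrM.
  rewrite [_ * `|l|]mulrC -mulrDl.
  by rewrite mulrC -ler_pdivlMr// ltW.
move=> t s e t0 e0.
have /has_derivativeP /(_ _ e0)[d d0 Hd] := dU t s t0.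
exists d => // h /andP[h0 hd].
by have := Hd h; rewrite (gtr0_norm h0) addr_ge0 ?(ltW h0)//; apply.
Qed.

Definition population (s : state) : R := 1 + (s.1.1 0)%:R + (s.1.1 1)%:R.

(** A split of type [a] into [j] raises the population size by at most
[j 0 + j 1], and there are at most [population s] individuals to split. *)
Lemma population_lyapunov : lyapunov (@birth_Q R b R1 R2) population
  (\sum_a moment b a) (\sum_a - b a (unitv a)).
Proof.
have b0 a : 0 <= - b a (unitv a) by rewrite oppr_ge0 rate_unit_le0.
have V0 s : 0 <= population s by rewrite !addr_ge0.
have V1 (s : state) a : (s.1.1 a)%:R <= population s.
  have := ler0n R (s.1.1 0); have := ler0n R (s.1.1 1).
  by move: a; apply: I2_ind; rewrite /population; lra.
have split_le a (s : state) (j : vec) :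
    population (split_state a s j) <= population s + ((j 0)%:R + (j 1)%:R).
  have le c : ((split_state a s j).1.1 c <= s.1.1 c + j c)%N by rewrite ffunE leq_add2r leq_subr.
  by have := le 0; have := le 1; rewrite -!(ler_nat R) !natrD /population; lra.
have bound0 a (s : state) (j : vec) : j != unitv a ->
    0 <= b a j * population (split_state a s j) <=
    population s * b a j + b a j * ((j 0)%:R + (j 1)%:R).
  move=> ju; have bj := rate_ge0 hb ju; rewrite mulr_ge0//=.
  by rewrite [population s * _]mulrC -mulrDr ler_wpM2l.
have sb a (s : state) : rsummable [set j | j != unitv a]
    (fun j => population s * b a j + b a j * ((j 0)%:R + (j 1)%:R)).
  apply: rsummableD.
  - by move=> j ju; rewrite mulr_ge0 ?(rate_ge0 hb).
  - by move=> j ju; rewrite mulr_ge0 ?(rate_ge0 hb)// addr_ge0.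
  - apply: rsummableZ => //; last exact: offspring_summable.
    by move=> j ju; exact: (rate_ge0 hb).
  - exact: moment_sum_summable.
have sV a (s : state) : rsummable [set j | j != unitv a]
    (fun j => b a j * population (split_state a s j)).
  by apply: rsummable_le (sb a s) => j /(bound0 a s) /andP[].
have jV (s : state) := jump_birth hb hR1 hR2 V0 (fun a => sV a s).
have qE (s : state) : - birth_Q b s s = \sum_a (s.1.1 a)%:R * - b a (unitv a).
  rewrite birth_QE -sumrN; apply: eq_bigr => a _.
  by rewrite split_rate_diag// mulrN.
split.
- by move=> s; rewrite /population -addrA lerDl addr_ge0.
- move=> s; rewrite qE mulr_suml; apply: ler_sum => a _.
  by rewrite mulrC ler_wpM2l.
- by move=> s; case: (jV s).
move=> s; have [_ ->] := jV s.
rewrite -opprB opprB qE mulrDl !mulr_suml -big_split; apply: ler_sum => a _ /=.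
have -> : moment b a * population s + (s.1.1 a)%:R * - b a (unitv a) * population s =
   (s.1.1 a)%:R * (population s * - b a (unitv a)) + population s * moment b a by ring.
apply: (@le_trans _ _ ((s.1.1 a)%:R * (population s * - b a (unitv a) + moment b a))).
  rewrite ler_wpM2l//; apply: (le_trans (rsum_le (bound0 a s) (sb a s))).
  rewrite rsumD.
  - rewrite rsumZ ?offspring_total//; first by move=> j ju; exact: (rate_ge0 hb).
    exact: offspring_summable.
  - by move=> j ju; rewrite mulr_ge0 ?(rate_ge0 hb).
  - by move=> j ju; rewrite mulr_ge0 ?(rate_ge0 hb)// addr_ge0.
  - apply: rsummableZ => //; last exact: offspring_summable.
    by move=> j ju; exact: (rate_ge0 hb).
  - exact: moment_sum_summable.
by rewrite mulrDr lerD2l ler_wpM2r ?moment_ge0.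
Qed.

Lemma backward_branching_unique (W W' : R -> state -> R) :
  backward_solution (@birth_Q R b R1 R2) W -> backward_solution (@birth_Q R b R1 R2) W' ->
  (forall s, W 0 s = W' 0 s) -> forall t s, 0 <= t -> W t s = W' t s.
Proof.
apply: backward_unique (birth_conservative hb hR1 hR2) population_lyapunov _ _.
  by apply: sumr_ge0 => a _; exact: moment_ge0.
by apply: sumr_ge0 => a _; rewrite oppr_ge0 rate_unit_le0.
Qed.

Definition single (a : 'I_2) : state := (unitv a, [ffun=> 0%N], [ffun=> 0%N]).

Lemma state_pgf_single x a : state_pgf x (single a) = x a.
Proof.
rewrite /state_pgf /= monom_unitv.
rewrite (@eq_monom _ _ _ _ (fun=> 0%N)) ?monom0; last by move=> m; rewrite ffunE.
by rewrite (@eq_monom _ _ _ _ (fun=> 0%N)) ?monom0 ?mul1r// => m; rewrite ffunE.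
Qed.

(** A solution is read off from the bounded backward solution that it defines, at
the states with a single individual. *)
Lemma ode_solution_unique (x : 'rV[R]_2) (u v : R -> 'rV[R]_2) :
  ode_solution b x y z u -> ode_solution b x y z v -> forall t, 0 <= t -> v t = u t.
Proof.
move=> su sv t t0; apply/rowP => a.
rewrite -!(state_pgf_single (_ : 'I_2 -> R)).
apply: (backward_branching_unique (ode_backward sv) (ode_backward su)) => // s.
by rewrite (ode_init su) (ode_init sv).
Qed.

Lemma ode_solution_exists (x : 'rV[R]_2) : in_cube (x 0) -> exists u, ode_solution b x y z u.
Proof.
move=> x01; have [u [u01 ux du]] := ode_exists hb hA2 weights_range x01.
by exists u; apply/ode_solutionP.
Qed.

End BranchingSolutions.

(** * Law of the chain and expectations of the counts *)

Section CountableExpectation.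
Variables (R : realType) (S : countType) (d : measure_display).
Variables (Omega : measurableType d) (P : probability Omega R) (W : Omega -> S).
Hypothesis mW : forall s, measurable [set w | W w = s].

Lemma measurable_countable_preimage (A : set S) : measurable (W @^-1` A).
Proof.
have -> : W @^-1` A = \bigcup_s (if s \in A then [set w | W w = s] else set0).
  rewrite -bigcup_mkcond; apply/seteqP; split => [w Aw|w [s As /= ws]].
    by exists (W w).
  by rewrite /preimage /= ws.
apply: countable_bigcupT_measurable => // s.
by case: ifP.
Qed.

Lemma integral_countable (g : S -> R) : (forall s, 0 <= g s) ->
  (\int[P]_w (g (W w))%:E = \esum_(s in setT) (g s)%:E * P [set w | W w = s])%E.
Proof.
move=> g0.
pose F k := [set w | choice.pickle (W w) = k].
have UF : \bigcup_k F k = setT by apply/seteqP; split => // w _; exists (choice.pickle (W w)).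
have mF k : measurable (F k).
  exact: (measurable_countable_preimage [set s | choice.pickle s = k]).
rewrite -[in LHS]UF ge0_integral_bigcup//; first last.
- by move=> i j _ _ [w [<- <-]].
- by move=> w _; rewrite lee_fin.
- rewrite UF => _ B mB; rewrite setTI.
  exact: (measurable_countable_preimage [set s | B (g s)%:E]).
have gk0 k : (0 <= \int[P]_(w in F k) (g (W w))%:E)%E.
  by apply: integral_ge0 => w _; rewrite lee_fin.
rewrite nneseries_esumT// (esumID (range (@choice.pickle S))); last by move=> k _.
rewrite [X in (_ + X)%E]esum1 ?adde0; last first.
  move=> k [_ Nk]; rewrite (_ : F k = set0) ?integral_set0//.
  by apply/seteqP; split => // w Fw; apply: Nk; exists (W w).
rewrite setTI esum_image; last by move=> s s' _ _; exact: (pcan_inj choice.pickleK).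
apply: eq_esum => s _.
have FE : F (choice.pickle s) = [set w | W w = s].
  apply/seteqP; split => [w|w /= ws]; last by rewrite /F /= ws.
  exact: (pcan_inj choice.pickleK).
rewrite FE -integral_cst//; apply: eq_integral => w.
by rewrite inE => /= ->.
Qed.

End CountableExpectation.

(** The finite-dimensional laws at time 0 and [t] are given by [p]; as the chain
starts at [s0] almost surely, the event at time 0 can be removed. *)
Lemma markov_law (R : realType) (S : countType) (q : S -> S -> R)
    (d : measure_display) (Omega : measurableType d) (P : probability Omega R)
    (W : R -> Omega -> S) (s0 : S) :
  markov_chain q P W -> P [set w | W 0 w = s0] = 1%E ->
  exists p : R -> S -> S -> R, [/\ transition_function p, has_Qmatrix p q &
    forall t s, 0 <= t -> P [set w | W t w = s] = (p t s0 s)%:E].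
Proof.
move=> [mW [p [tp qp Hp]]] P0; exists p; split=> // t s t0.
have := Hp 0%N (fun=> 0) (fun=> s0) 0 t s0 s _ (lexx 0) t0.
have noI (i : 'I_0) : False by case: i.
rewrite add0r => /(_ (fun i => False_ind _ (noI i))).
have -> : [set w | (forall m : 'I_0, W 0 w = s0) /\ W 0 w = s0] = [set w | W 0 w = s0].
  by apply/seteqP; split => [w []//|w /= ws]; split=> // i; case: (noI i).
rewrite P0 mul1e => <-.
have -> : [set w | [/\ forall m : 'I_0, W 0 w = s0, W 0 w = s0 & W t w = s]] =
    [set w | W t w = s] `&` [set w | W 0 w = s0].
  by apply/seteqP; split => [w []//|w [/= ? ?]]; split=> // i; case: (noI i).
have mt := mW t s t0; have m0 := mW 0 s0 (lexx 0).
apply/eqP; rewrite eq_le measureIl ?andbT//.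
have -> : P [set w | W t w = s] =
  P (([set w | W t w = s] `&` [set w | W 0 w = s0]) `|`
     ([set w | W t w = s] `\` [set w | W 0 w = s0])).
  by rewrite setUIDK.
have PD : P ([set w | W t w = s] `\` [set w | W 0 w = s0]) = 0%E.
  apply: (@subset_measure0 _ _ _ P _ (~` [set w | W 0 w = s0])).
  - exact: measurableD.
  - exact: measurableC.
  - by move=> w [].
  - by have := probability_setC P m0; rewrite P0 subee.
have mI := measurableI _ _ mt m0; have mD := measurableD mt m0.
apply: (le_trans (measureU2 P mI mD)).
rewrite [X in (_ + X)%E](_ : _ = 0%E); [by rewrite adde0|exact: PD].
Qed.

Section CountsExpectation.
Variables (R : realType) (b : 'I_2 -> vec -> R) (R1 R2 : {fset vec}).
Hypotheses (hb : offspring_rates b) (hA2 : assumption_A2 b).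
Hypotheses (hR1 : unitv 0 \notin R1) (hR2 : unitv 1 \notin R2).

(** Both sides are values at [single R1 R2 k] of bounded solutions of the backward
equation that start from [marks y z], the second because [u 0] is (1, 1). *)
Lemma expectation_counts (k : 'I_2) (d : measure_display) (Omega : measurableType d)
    (P : probability Omega R) (X : R -> Omega -> vec)
    (Y : R -> Omega -> {ffun R1 -> nat}) (Z : R -> Omega -> {ffun R2 -> nat})
    (y : {ffun R1 -> R}) (z : {ffun R2 -> R}) (u : R -> 'rV[R]_2) :
  branching_with_counts b k P X Y Z -> in_cube y -> in_cube z ->
  ode_solution b (const_mx 1) y z u -> forall t, 0 <= t ->
  ('E_P[(fun w => (monom y (Y t w) * monom z (Z t w))%R)] = (u t 0 k)%:E)%E.
Proof.
move=> [hW hinit] y01 z01 su t t0.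
have P0 : P [set w | (X 0 w, Y 0 w, Z 0 w) = single R1 R2 k] = 1%E.
  rewrite -hinit; congr (P _); apply/seteqP; split => w /=; first by move=> [-> -> ->].
  by move=> [-> -> ->].
have [p [tp qp law]] := markov_law hW P0.
have m01 s : 0 <= marks y z s <= 1.
  by rewrite marks_ge0//= mulr_ile1 ?monom_ge0 ?monom_le1.
have m0 s : 0 <= marks y z s by case/andP: (m01 s).
rewrite unlock (@integral_countable _ _ _ _ P (fun w => (X t w, Y t w, Z t w) : bstate R1 R2)
   _ (marks y z))//; last by move=> s; exact: (chain_measurable hW).
have ubw := ode_backward hb hR1 hR2 y01 z01 su.
have pbw := transition_backward (birth_conservative hb hR1 hR2) tp qp m01.
rewrite -(state_pgf_single y z (u t 0)).
rewrite -(backward_branching_unique hb hA2 hR1 hR2 pbw ubw)//; last first.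
  move=> s; rewrite (average0 tp)// (ode_init su) /state_pgf /marks.
  by rewrite (_ : monom _ s.1.1 = 1) ?mulr1// /monom big1// => a _; rewrite mxE expr1n.
rewrite /average -esum_rsum; first last.
- exact: (average_summable tp).
- by move=> s _; rewrite mulr_ge0// (trans_ge0 tp).
by apply: eq_esum => s _; rewrite law// mulrC -EFinM.
Qed.

End CountsExpectation.

Lemma positive_set_no_unit (R : realType) (b : 'I_2 -> vec -> R) (A : {fset vec}) a :
  offspring_rates b -> (forall j, j \in A -> 0 < b a j) -> unitv a \notin A.
Proof.
by move=> hb hA; apply/negP => /hA; rewrite ltNge rate_unit_le0.
Qed.

Theorem theorem3p2 (R : realType) (b : 'I_2 -> vec -> R)
    (R1 R2 : {fset vec})
    (hb : offspring_rates b)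
    (hA1 : assumption_A1 b) (hA2 : assumption_A2 b) (hA3 : assumption_A3 b)
    (hR1 : R1 != fset0) (hR2 : R2 != fset0)
    (hbR1 : forall j, j \in R1 -> 0 < b 0 j)
    (hbR2 : forall j, j \in R2 -> 0 < b 1 j) :
  exists G : R -> 'rV[R]_2 -> {ffun R1 -> R} -> {ffun R2 -> R} -> 'rV[R]_2,
    (forall (x : 'rV[R]_2) (y : {ffun R1 -> R}) (z : {ffun R2 -> R}),
       in_cube (x 0) -> in_cube y -> in_cube z ->
       unique_ode_solution b x y z (fun t => G t x y z)) /\
    forall (k : 'I_2) (d : measure_display) (Omega : measurableType d)
      (P : probability Omega R) (X : R -> Omega -> vec)
      (Y : R -> Omega -> {ffun R1 -> nat}) (Z : R -> Omega -> {ffun R2 -> nat}),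
      branching_with_counts b k P X Y Z ->
      forall t : R, 0 <= t ->
      [/\ forall (y : {ffun R1 -> R}) (z : {ffun R2 -> R}),
            in_halfopen_cube y -> in_halfopen_cube z ->
            ('E_P[(fun w => monom y (Y t w) * monom z (Z t w))%R]
             = (G t (const_mx 1%R) y z 0%R k)%:E)%E,
          forall y : {ffun R1 -> R}, in_halfopen_cube y ->
            ('E_P[(fun w => monom y (Y t w))]
             = (G t (const_mx 1%R) y [ffun=> 1%R] 0%R k)%:E)%E
        & forall z : {ffun R2 -> R}, in_halfopen_cube z ->
            ('E_P[(fun w => monom z (Z t w))]
             = (G t (const_mx 1%R) [ffun=> 1%R] z 0%R k)%:E)%E].
Proof.
have uR1 := positive_set_no_unit hb hbR1.
have uR2 := positive_set_no_unit hb hbR2.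
pose sol (x : 'rV[R]_2) (y : {ffun R1 -> R}) (z : {ffun R2 -> R}) : R -> 'rV[R]_2 :=
  if pselect (exists u, ode_solution b x y z u) is left H then projT1 (cid H) else fun=> 0.
have solP (x : 'rV[R]_2) (y : {ffun R1 -> R}) (z : {ffun R2 -> R}) :
    in_cube (x 0) -> in_cube y -> in_cube z -> ode_solution b x y z (sol x y z).
  move=> x01 y01 z01; rewrite /sol; case: pselect => [H|[]]; first exact: (projT2 (cid H)).
  exact: (ode_solution_exists hb hA2 uR1 uR2 y01 z01 x01).
have one_cube (I : finType) : in_cube ([ffun=> 1%R] : {ffun I -> R}).
  by move=> i; rewrite ffunE ler01 lexx.
have monom1 (I : finType) j : monom ([ffun=> 1%R] : {ffun I -> R}) j = 1.
  by rewrite /monom big1// => i _; rewrite ffunE expr1n.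
have halfopen (I : finType) (v : I -> R) : in_halfopen_cube v -> in_cube v.
  by move=> v01 i; have /andP[-> /ltW] := v01 i.
exists (fun t x y z => sol x y z t); split.
  move=> x y z x01 y01 z01; split; first exact: solP.
  move=> v sv t t0.
  exact: (ode_solution_unique hb hA2 uR1 uR2 y01 z01 (solP _ _ _ x01 y01 z01) sv t0).
move=> k d Omega P X Y Z hW t t0.
have E (y : {ffun R1 -> R}) (z : {ffun R2 -> R}) : in_cube y -> in_cube z ->
    ('E_P[(fun w => (monom y (Y t w) * monom z (Z t w))%R)] = (sol (const_mx 1) y z t 0 k)%:E)%E.
  move=> y01 z01; apply: (expectation_counts hb hA2 uR1 uR2 hW) => //.
  by apply: solP => // a; rewrite mxE ler01 lexx.
split.
- by move=> y z /halfopen y01 /halfopen z01; exact: E.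
- move=> y /halfopen y01; rewrite -E//; congr expectation.
  by apply/funext => w; rewrite monom1 mulr1.
- move=> z /halfopen z01; rewrite -E//; congr expectation.
  by apply/funext => w; rewrite monom1 mul1r.
Qed.
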